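(* Let $\Gamma$ be a compact Dirichlet tree. Then $$\frac{\lambda_2(\Gamma)}{\lambda_1(\Gamma)} \leq 4,$$ with equality if and only if $\Gamma$ is an interval or an equilateral star graph (on any number of edges).
   Context: A compact metric graph $\Gamma=(\mathcal V,\mathcal E)$ has finitely many vertices and edges; each edge $e$ is identified with an interval $[0,\ell_e]$, $0<\ell_e<\infty$, whose endpoints are attached to vertices; loops and parallel edges are permitted in general; $\Gamma$ is connected. It is a tree if its first Betti number $|\mathcal E|-|\mathcal V|+1$ is $0$. A leaf is a vertex of degree one. Vertices of degree two are regarded as suppressed (inserting or deleting a degree-two vertex with Kirchhoff conditions does not change the graph or its operator). $C(\Gamma)$ denotes the continuous functions on $\Gamma$ and $H^1(\Gamma)=\{f\in C(\Gamma): f|_e\in H^1(e)\ \forall e\in\mathcal E\}$. A compact Dirichlet tree is a compact tree $\Gamma$ equipped with the Laplacian $-\Delta$ (acting as $-f''$ on each edge) with a Dirichlet (zero) condition at every leaf and, at every other vertex, the Kirchhoff condition (continuity, and the sum of the derivatives along all incident edges, all oriented into the vertex, is zero). Equivalently, $-\Delta$ is the self-adjoint operator on $L^2(\Gamma)$ associated with the form $\int_\Gamma f'\overline{g}'\,dx$ on the set of $f\in H^1(\Gamma)$ vanishing at all leaves. Its eigenvalues, counted with multiplicity, are $0<\lambda_1(\Gamma)<\lambda_2(\Gamma)\le\lambda_3(\Gamma)\le\dots$. A star graph consists of edges all joined at one common central vertex, their other endpoints being distinct leaves; it is equilateral if all its edges have the same length (an equilateral star on two edges is an interval). *)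

(* Defs.v *)
From HB Require Import structures.
From mathcomp Require Import all_boot all_order all_algebra.
From mathcomp Require Import all_classical all_reals all_analysis.
Import Order.TTheory GRing.Theory Num.Theory.
Import numFieldNormedType.Exports.

Set Implicit Arguments.
Unset Strict Implicit.
Unset Printing Implicit Defensive.

Local Open Scope classical_set_scope.
Local Open Scope ring_scope.

(** * Compact metric graphs *)

(** The edge [e] is a copy of the interval [0, len e], its endpoint [0] being
    attached to [src e] and its endpoint [len e] to [tgt e].  The orientation
    is only a choice of coordinate.  Loops and parallel edges are allowed. *)
Record metric_graph (R : realType) := MetricGraph {
  vertex : finType;
  edge : finType;
  src : edge -> vertex;
  tgt : edge -> vertex;
  len : edge -> R;
  len_gt0 : forall e, 0 < len e }.

Section Combinatorics.
Variables (R : realType) (G : metric_graph R).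
Implicit Types (u v : vertex G) (e : edge G).

Definition adjacent : rel (vertex G) := fun u v =>
  [exists e : edge G,
    ((src e == u) && (tgt e == v)) || ((src e == v) && (tgt e == u))].

Definition connected_graph : Prop := forall u v, connect adjacent u v.

(** A loop contributes twice to the degree of its vertex. *)
Definition degree v : nat :=
  (#|[set e | src e == v]%SET| + #|[set e | tgt e == v]%SET|)%N.

Definition leaf v : bool := degree v == 1%N.

Definition betti1 : int := (#|edge G|%:Z - #|vertex G|%:Z + 1)%R.

Definition is_tree : Prop := connected_graph /\ betti1 = 0.

(** Every vertex of degree two has been suppressed. *)
Definition suppressed : Prop := forall v, degree v != 2%N.

Definition joins e u v : Prop :=
  (src e = u /\ tgt e = v) \/ (src e = v /\ tgt e = u).

(** Intervals and stars, for graphs whose vertices of degree two have been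
    suppressed. *)
Definition interval_graph : Prop :=
  exists (e : edge G) (u v : vertex G),
    [/\ u != v, joins e u v, forall e', e' = e & forall w, w = u \/ w = v].

Definition star_graph : Prop :=
  exists (c : vertex G) (far : edge G -> vertex G),
    [/\ injective far,
        forall e, far e != c /\ leaf (far e),
        forall e, joins e c (far e) &
        forall v, v = c \/ exists e, v = far e].

Definition equilateral : Prop := forall e e' : edge G, len e = len e'.

Definition equilateral_star_graph : Prop := star_graph /\ equilateral.

End Combinatorics.

(** * The Laplacian of a Dirichlet tree *)

(** [f] belongs to H^1(0, l), in its continuous representative on [0, l], and
    its weak derivative is (the class of) the square-integrable [g]. *)
Definition H1_deriv (R : realType) (l : R) (f g : R -> R) : Prop :=
  [/\ measurable_fun `[0, l] g,
      (@lebesgue_measure R).-integrable `[0, l] (EFin \o (fun x => g x ^+ 2)) &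
      forall x, 0 <= x <= l -> f x = f 0 + \int[@lebesgue_measure R]_(t in `[0, x]) g t].

Section Laplacian.
Variables (R : realType) (G : metric_graph R).

(** A function on [G] is a family [f : edge G -> R -> R]; only the values
    [f e x] with [0 <= x <= len e] matter. *)
Implicit Types (f h : edge G -> R -> R).

(** [phi] lists the values at the vertices. *)
Definition continuous_at_vertices f (phi : vertex G -> R) : Prop :=
  forall e, f e 0 = phi (src e) /\ f e (len e) = phi (tgt e).

(** Sum at [v] of the derivatives [f1] along the incident edges, all oriented
    into [v] (both ends of a loop are counted). *)
Definition flux (f1 : edge G -> R -> R) (v : vertex G) : R :=
  \sum_(e | tgt e == v) f1 e (len e) - \sum_(e | src e == v) f1 e 0.

(** [f] is in the domain of the operator [- Delta] of [L^2(G)], with Dirichlet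
    conditions at the leaves and Kirchhoff conditions at the other vertices,
    and [- Delta f = h] almost everywhere.  The domain consists of functions
    that are H^2 on every edge, so that [f1], the derivative of [f], has a
    continuous representative with values at the endpoints. *)
Definition dirichlet_laplacian f h : Prop :=
  exists (f1 f2 : edge G -> R -> R) (phi : vertex G -> R),
    [/\ forall e, H1_deriv (len e) (f e) (f1 e) /\
                  H1_deriv (len e) (f1 e) (f2 e),
        continuous_at_vertices f phi,
        forall v, leaf v -> phi v = 0,
        forall v, ~~ leaf v -> flux f1 v = 0 &
        forall e, {ae @lebesgue_measure R,
          forall x, x \in `[0, len e] -> - f2 e x = h e x}].

Definition in_eigenspace (lam : R) f : Prop :=
  dirichlet_laplacian f (fun e x => lam * f e x).

Definition lin_indep k (f : 'I_k -> edge G -> R -> R) : Prop :=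
  forall c : 'I_k -> R,
    (forall e x, 0 <= x <= len e -> \sum_i c i * f i e x = 0) ->
    forall i, c i = 0.

(** At least [k] eigenvalues, counted with multiplicity, satisfy [P]: as
    eigenspaces of different eigenvalues are independent, the sum of the
    dimensions of these eigenspaces is the largest number of linearly
    independent functions each of which belongs to one of them. *)
Definition eigenvalue_count_ge (P : set R) (k : nat) : Prop :=
  exists (lam : 'I_k -> R) (f : 'I_k -> edge G -> R -> R),
    (forall i, P (lam i) /\ in_eigenspace (lam i) (f i)) /\ lin_indep f.

(** [l] is the [k]-th eigenvalue (k >= 1) in nondecreasing order, counted with
    multiplicity: at least [k] eigenvalues are at most [l], and fewer than [k]
    are less than [l]. *)
Definition is_kth_eigenvalue (k : nat) (l : R) : Prop :=
  eigenvalue_count_ge [set x | x <= l] k /\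
  ~ eigenvalue_count_ge [set x | x < l] k.

End Laplacian.

(* Main.v *)
(** Root the tree at a leaf.  For each frequency [s] a branch carries a solution
    of [- u'' = s^2 u] that vanishes at its leaves and satisfies the Kirchhoff
    conditions; write [(u, u' / s)] at the root of the branch as a multiple of
    [(sin a, cos a)].  Along an edge of length [l] the angle [a] grows by [s l],
    and where branches meet the cotangents add up.  The eigenvalues of the tree
    are the squares of the [s] for which [u] vanishes at the root of the tree.

    Let [k^2] be the first eigenvalue.  Cut the tree at a stationary point of the
    ground state, so that both sides have angle [pi / 2] at frequency [k].
    Doubling the frequency at least doubles the angle: along edges it does so
    exactly, and at a vertex where the cotangents [c_i] are positive
    [\sum_i (c_i - 1 / c_i) < c - 1 / c] for [c = \sum_i c_i].  Hence both sides
    have a Dirichlet zero at or before [2 k], and between these two zeros there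
    is an eigenfrequency.  It is below [2 k] unless no branching
    occurred on either side of the cut, that is, unless the tree is an interval
    or an equilateral star; for these the spectrum is explicit. *)

Require Import Defs.
From HB Require Import structures.
From mathcomp Require Import all_boot all_order all_algebra.
From mathcomp Require Import all_classical all_reals all_analysis.
From mathcomp Require Import measurable_realfun zify ring lra.
Import Order.TTheory GRing.Theory Num.Theory.
Import numFieldNormedType.Exports.

Set Implicit Arguments.
Unset Strict Implicit.
Unset Printing Implicit Defensive.

Local Open Scope classical_set_scope.
Local Open Scope ring_scope.

(** * Zeros of continuous real functions *)

Section RealFunctions.
Variable R : realType.
Implicit Types (f g : R -> R) (a b c x y : R).

(** No angle is ever defined. A branch carries a pair [bstate] that is polynomial in sines and
    cosines, and the growth of its angle is a Wronskian inequality: the cotangent [bder / bval] is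
    nonincreasing in [s] wherever [bval] does not vanish. The price is that the pair becomes (0, 0)
    when two branches at a vertex have a Dirichlet zero at the same frequency, and then the angle is
    lost. Up to and including the ground frequency [k], positivity of the secular function excludes
    this, which also makes the first eigenvalue simple. Beyond [k] an eigenfrequency is found by
    contradiction: if the secular function kept its sign, the relevant zeros of one side would have
    slopes of a strict sign, and such zeros are nondegenerate and crossed in one direction only.
    Degenerate frequencies must still produce eigenfunctions; these are built by choosing weights at
    each vertex, so that the spectrum is exactly the zero set of one function of [s]. *)

Lemma continuous_mul f g : continuous f -> continuous g ->
  continuous (fun x => f x * g x).
Proof. by move=> cf cg s; apply: continuousM; [exact: cf|exact: cg]. Qed.

Lemma continuous_add f g : continuous f -> continuous g ->
  continuous (fun x => f x + g x).
Proof. by move=> cf cg s; apply: continuousD; [exact: cf|exact: cg]. Qed.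

Lemma continuous_sub f g : continuous f -> continuous g ->
  continuous (fun x => f x - g x).
Proof. by move=> cf cg s; apply: continuousB; [exact: cf|exact: cg]. Qed.

Lemma pos_near f x : {for x, continuous f} -> 0 < f x ->
  exists2 e, 0 < e & forall y, `|x - y| < e -> 0 < f y.
Proof.
move=> cf fx.
have /cvgr_gt/(_ _ fx) : f @ x --> f x by exact: cf.
move/nbhs_ballP => [e /= e0 he]; by exists e.
Qed.

Lemma IVT_zero f a b : continuous f -> a < b -> f a * f b < 0 ->
  exists2 c, a < c < b & f c = 0.
Proof.
move=> cf ab fab.
have [|c] := @IVT R f a b 0 (ltW ab) (continuous_subspaceT cf).
  case: (ltP (f a) 0) => fa.
    have fb : 0 < f b by rewrite -(nmulr_rlt0 _ fa).
    by rewrite ge_min le_max (ltW fa) (ltW fb) orbT.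
  have fa0 : 0 < f a.
    by rewrite lt_neqAle fa andbT; apply/eqP => fa0; rewrite -fa0 mul0r ltxx in fab.
  have fb : f b < 0 by rewrite -(pmulr_rlt0 _ fa0).
  by rewrite ge_min le_max (ltW fa0) (ltW fb) orbT.
rewrite in_itv /= => /andP[ac cb] fc; exists c => //.
rewrite !lt_neqAle ac cb !andbT; apply/andP; split; apply/eqP => E; move: fab.
  by rewrite E fc mul0r ltxx.
by rewrite -E fc mulr0 ltxx.
Qed.

Lemma nonzero_same_sign f a b : continuous f -> a <= b ->
  (forall x, a <= x <= b -> f x != 0) -> 0 < f a * f b.
Proof.
move=> cf; rewrite le_eqVlt => /predU1P[->|ab] h.
  have := h b; rewrite lexx => /(_ isT) fb.
  by rewrite -expr2 exprn_even_gt0.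
rewrite lt0r mulf_neq0 ?h ?lexx ?(ltW ab)//= leNgt; apply/negP => fab.
have [c /andP[ac cb] /eqP] := IVT_zero cf ab fab.
by rewrite (negbTE (h c _)) // !ltW.
Qed.

Lemma first_zero f a b : continuous f -> f b = 0 -> a <= b ->
  exists c, [/\ a <= c <= b, f c = 0 & forall x, a <= x < c -> f x != 0].
Proof.
move=> cf fb ab; pose Z : set R := [set x | a <= x <= b /\ f x = 0].
have Zb : Z b by split => //; rewrite ab lexx.
have lb : has_lbound Z by exists a => x [/andP[]].
have hZ : has_inf Z by split => //; exists b.
have ac : a <= inf Z by apply: lb_le_inf; [exists b|move=> x [/andP[]]].
have cb : inf Z <= b by exact: ge_inf.
exists (inf Z); rewrite ac cb; split => //.
  apply/eqP; apply: contraT => fn0.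
  (* Squaring makes a nonzero value of either sign positive, so a whole neighbourhood of the infimum
     misses the zero set. *)
  have [||e e0 he] := @pos_near (fun x => f x ^+ 2) (inf Z).
  - by apply: continuousM; exact: cf.
  - by rewrite exprn_even_gt0.
  have [y [yab fy] ye] := inf_adherent e0 hZ.
  have iy : inf Z <= y by apply: ge_inf.
  have := he y; rewrite fy expr0n /= ltxx; apply.
  by rewrite distrC ger0_norm ?subr_ge0// ltrBlDr addrC.
move=> x /andP[ax xc]; apply/eqP => fx.
have : inf Z <= x by apply: ge_inf => //; split=> //; rewrite ax (le_trans (ltW xc)).
by rewrite leNgt xc.
Qed.

Lemma last_zero f a b : continuous f -> f a = 0 -> a <= b ->
  exists c, [/\ a <= c <= b, f c = 0 & forall x, c < x <= b -> f x != 0].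
Proof.
move=> cf fa ab; have cfN : continuous (f \o -%R).
  by move=> x; apply: continuous_comp; [exact: opp_continuous|exact: cf].
have [||c [/andP[bc ca] fc h]] := @first_zero (f \o -%R) (- b) (- a) cfN.
- by rewrite /= opprK.
- by rewrite lerN2.
exists (- c); rewrite lerNr ca lerNl bc; split => // x /andP[cx xb].
by have := h (- x); rewrite /= opprK lerN2 xb /= ltrNl; apply.
Qed.

(** Carries a bound on a cotangent, multiplied by the value, to a frequency at which the value
    vanishes and the cotangent does not exist. *)
Lemma le_at_right_end f g a b : continuous f -> continuous g -> a < b ->
  (forall x, a <= x < b -> f x <= g x) -> f b <= g b.
Proof.
move=> cf cg ab h; rewrite leNgt; apply/negP => gf.
have [||e e0 he] := @pos_near (fun x => f x - g x) b.
- by apply: continuousB; [exact: cf|exact: cg].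
- by rewrite subr_gt0.
pose x := Num.max a (b - e / 2).
have xb : x < b by rewrite /x gt_max ab ltrBlDr ltrDl divr_gt0.
have := h x; rewrite xb le_max lexx /= => /(_ isT); rewrite leNgt -subr_gt0 he //.
rewrite ger0_norm ?subr_ge0 ?ltW//.
have : b - e / 2 <= x by rewrite le_max lexx orbT.
lra.
Qed.

Lemma le_at_left_end f g a b : continuous f -> continuous g -> a < b ->
  (forall x, a < x <= b -> f x <= g x) -> f a <= g a.
Proof.
move=> cf cg ab h.
have cN (k : R -> R) : continuous k -> continuous (k \o -%R).
  by move=> ck x; apply: continuous_comp; [exact: opp_continuous|exact: ck].
have := @le_at_right_end (f \o -%R) (g \o -%R) (- b) (- a) (cN _ cf) (cN _ cg).
rewrite ltrN2 /= opprK; apply => // x /andP[bx xa]; apply: h.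
by rewrite ltrNr xa lerNl bx.
Qed.

End RealFunctions.

(** * Canonical solutions on rooted branches *)

(* [Edge l] ends in a Dirichlet leaf; [Ext l B] puts an edge of length [l] in
   front of the root of [B]; [Join B C] identifies the roots of [B] and [C]. *)
Inductive branch (R : Type) : Type :=
| Edge of R
| Ext of R & branch R
| Join of branch R & branch R.

Section BranchStates.
Variable R : realType.
Implicit Types (A B C : branch R) (k l s t x y : R).

(* Value and derivative, divided by [s], at the root of the canonical solution at
   frequency [s]; the derivative points out of the branch. *)
Fixpoint bstate B s : R * R :=
  match B with
  | Edge l => (sin (s * l), cos (s * l))
  | Ext l B => let p := bstate B s in
      (p.1 * cos (s * l) + p.2 * sin (s * l),
       p.2 * cos (s * l) - p.1 * sin (s * l))
  | Join B1 B2 => let p := bstate B1 s in let q := bstate B2 s in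
      (p.1 * q.1, p.2 * q.1 + q.2 * p.1)
  end.

Definition bval B s := (bstate B s).1.
Definition bder B s := (bstate B s).2.

Lemma bval_Edge l s : bval (Edge l) s = sin (s * l). Proof. by []. Qed.
Lemma bder_Edge l s : bder (Edge l) s = cos (s * l). Proof. by []. Qed.
Lemma bval_Ext l B s :
  bval (Ext l B) s = bval B s * cos (s * l) + bder B s * sin (s * l).
Proof. by []. Qed.
Lemma bder_Ext l B s :
  bder (Ext l B) s = bder B s * cos (s * l) - bval B s * sin (s * l).
Proof. by []. Qed.
Lemma bval_Join B C s : bval (Join B C) s = bval B s * bval C s.
Proof. by []. Qed.
Lemma bder_Join B C s :
  bder (Join B C) s = bder B s * bval C s + bder C s * bval B s.
Proof. by []. Qed.

Definition bE := (bval_Edge, bder_Edge, bval_Ext, bder_Ext, bval_Join, bder_Join).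

Fixpoint wf B : Prop :=
  match B with
  | Edge l => 0 < l
  | Ext l B => 0 < l /\ wf B
  | Join B C => wf B /\ wf C
  end.

(* Zero exactly when [s ^ 2] is an eigenvalue of the tree obtained by gluing [A]
   and [C] at their roots. *)
Definition secular A C s := bval A s * bder C s + bder A s * bval C s.

Lemma secularC A C s : secular A C s = secular C A s.
Proof. by rewrite /secular; ring. Qed.

(** The cut may slide along an edge or past a vertex without changing the secular function. This
    allows induction on one side of the cut while the rest of the tree accumulates on the other. *)
Lemma secular_Ext l A C s : secular (Ext l A) C s = secular A (Ext l C) s.
Proof. by rewrite /secular !bE; ring. Qed.

Lemma secular_Join A B C s : secular (Join A B) C s = secular A (Join B C) s.
Proof. by rewrite /secular !bE; ring. Qed.

Lemma secular_JoinC A B C s : secular (Join A B) C s = secular B (Join A C) s.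
Proof. by rewrite /secular !bE; ring. Qed.

(** An edge rotates the state by [s * l], so only a [Join] can create the state (0, 0). *)
Lemma norm_Ext l B s : bval (Ext l B) s ^+ 2 + bder (Ext l B) s ^+ 2 =
  bval B s ^+ 2 + bder B s ^+ 2.
Proof.
rewrite -[RHS]mulr1 -(cos2Dsin2 (s * l)) !bE; ring.
Qed.

Lemma is_derive_sinM s l : is_derive s 1 (fun t => sin (t * l)) (cos (s * l) * l).
Proof.
have h : is_derive s 1 (fun t : R => t * l) l.
  by apply: is_derive_eq; rewrite /GRing.scale/= mulr0 add0r mulr1.
exact: (@is_derive1_comp R sin (fun t => t * l) s _ _ (is_derive_sin _) h).
Qed.

Lemma is_derive_cosM s l : is_derive s 1 (fun t => cos (t * l)) (- sin (s * l) * l).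
Proof.
have h : is_derive s 1 (fun t : R => t * l) l.
  by apply: is_derive_eq; rewrite /GRing.scale/= mulr0 add0r mulr1.
exact: (@is_derive1_comp R cos (fun t => t * l) s _ _ (is_derive_cos _) h).
Qed.

(* The last two clauses say that the angle of the state increases with [s]. *)
Lemma branch_derive B s : wf B -> exists du dv,
  [/\ is_derive s 1 (bval B) du, is_derive s 1 (bder B) dv,
      0 <= du * bder B s - dv * bval B s &
      bval B s ^+ 2 + bder B s ^+ 2 != 0 ->
      0 < du * bder B s - dv * bval B s].
Proof.
elim: B => [l|l B IH|B IHB C IHC] /=.
- move=> l0; exists (cos (s * l) * l), (- sin (s * l) * l).
  split; [exact: is_derive_sinM|exact: is_derive_cosM| |];
  have -> : cos (s * l) * l * bder (Edge l) s - - sin (s * l) * l * bval (Edge l) s = l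
    by rewrite -[RHS]mulr1 -(cos2Dsin2 (s * l)) !bE; ring.
  + exact: ltW.
  + by [].
- move=> [l0 /IH [du [dv [hu hv w1 w2]]]].
  have hs := is_derive_sinM s l; have hc := is_derive_cosM s l.
  eexists; eexists; split.
  + exact: (is_deriveD (is_deriveM hu hc) (is_deriveM hv hs)).
  + exact: (is_deriveB (is_deriveM hv hc) (is_deriveM hu hs)).
  + rewrite !bE /GRing.scale /=; set u := bval B s; set v := bder B s;
    set c := cos (s * l); set d := sin (s * l).
    (* A fixed rotation preserves the Wronskian; the dependence of its angle on [s] adds [l] times
       the squared norm of the state. *)
    have -> : (u * (- d * l) + c * du + (v * (c * l) + d * dv)) * (v * c - u * d) -
     (v * (- d * l) + c * dv - (u * (c * l) + d * du)) * (u * c + v * d) =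
     ((du * v - dv * u) + l * (u ^+ 2 + v ^+ 2)) * (c ^+ 2 + d ^+ 2) by ring.
    by rewrite cos2Dsin2 mulr1 addr_ge0 // mulr_ge0 ?(ltW l0) // addr_ge0 ?sqr_ge0.
  + move=> n0; rewrite !bE /GRing.scale /=; set u := bval B s; set v := bder B s;
    set c := cos (s * l); set d := sin (s * l).
    have -> : (u * (- d * l) + c * du + (v * (c * l) + d * dv)) * (v * c - u * d) -
     (v * (- d * l) + c * dv - (u * (c * l) + d * du)) * (u * c + v * d) =
     ((du * v - dv * u) + l * (u ^+ 2 + v ^+ 2)) * (c ^+ 2 + d ^+ 2) by ring.
    rewrite cos2Dsin2 mulr1 ltr_pwDr // mulr_gt0 // lt0r addr_ge0 ?sqr_ge0 // andbT.
    by rewrite -(norm_Ext l).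
- move=> [/IHB [du [dv [hu hv w1 w2]]] /IHC [du' [dv' [hu' hv' w1' w2']]]].
  eexists; eexists; split.
  + exact: (is_deriveM hu hu').
  + exact: (is_deriveD (is_deriveM hv hu') (is_deriveM hv' hu)).
  + rewrite !bE /GRing.scale /=; move: w1 w2 w1' w2';
    set u := bval B s; set v := bder B s;
    set u' := bval C s; set v' := bder C s => w1 w2 w1' w2'.
    have -> : (u * du' + u' * du) * (v * u' + v' * u) -
     (v * du' + u' * dv + (v' * du + u * dv')) * (u * u') =
     u' ^+ 2 * (du * v - dv * u) + u ^+ 2 * (du' * v' - dv' * u') by ring.
    by rewrite addr_ge0 // mulr_ge0 // sqr_ge0.
  + rewrite !bE /GRing.scale /=; move: w1 w2 w1' w2';
    set u := bval B s; set v := bder B s;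
    set u' := bval C s; set v' := bder C s => w1 w2 w1' w2'.
    have -> : (u * du' + u' * du) * (v * u' + v' * u) -
     (v * du' + u' * dv + (v' * du + u * dv')) * (u * u') =
     u' ^+ 2 * (du * v - dv * u) + u ^+ 2 * (du' * v' - dv' * u') by ring.
    have sq (a b : R) : a != 0 -> a ^+ 2 + b ^+ 2 != 0.
      by move=> a0; rewrite gt_eqF // ltr_pwDl ?sqr_ge0 // exprn_even_gt0.
    (* If just one value vanishes, the branch carrying it has a nonzero slope and contributes
       strictly; if both vanish, the joined state is (0, 0). *)
    have [u0|u0] := eqVneq u 0.
      have [u0'|u0'] := eqVneq u' 0.
        by rewrite u0 u0' !(mulr0, mul0r, addr0) expr0n /= addr0 eqxx.
      rewrite u0 !(mul0r, mulr0, addr0, add0r) expr0n /= add0r mul0r addr0 sqrf_eq0.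
      rewrite mulf_eq0 negb_or => /andP[v0 _]; rewrite mulr_gt0 ?exprn_even_gt0 //.
      by have := w2; rewrite u0 mulr0; apply; rewrite addrC sq.
    have [u0'|u0'] := eqVneq u' 0.
      rewrite u0' !(mul0r, mulr0, addr0, add0r) expr0n /= add0r mul0r add0r sqrf_eq0.
      rewrite mulf_eq0 negb_or => /andP[v0 _]; rewrite mulr_gt0 ?exprn_even_gt0 //.
      by have := w2'; rewrite u0' mulr0; apply; rewrite addrC sq.
    move=> _; apply: addr_gt0; rewrite mulr_gt0 ?exprn_even_gt0 //.
      by apply: w2; exact: sq.
    by apply: w2'; exact: sq.
Qed.

Lemma continuous_sinM l : continuous (fun s : R => sin (s * l)).
Proof.
move=> s; apply/differentiable_continuous/derivable1_diffP.
by have [] := is_derive_sinM s l.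
Qed.

Lemma continuous_cosM l : continuous (fun s : R => cos (s * l)).
Proof.
move=> s; apply/differentiable_continuous/derivable1_diffP.
by have [] := is_derive_cosM s l.
Qed.

Lemma bstate_continuous B : continuous (bval B) /\ continuous (bder B).
Proof.
elim: B => [l|l B [cu cv]|B [cu cv] C [cu' cv']].
- by split; [exact: continuous_sinM|exact: continuous_cosM].
- have cs := @continuous_sinM l; have cc := @continuous_cosM l.
  split.
    have h : continuous (fun s => bval B s * cos (s * l) + bder B s * sin (s * l)).
      exact: continuous_add (continuous_mul cu cc) (continuous_mul cv cs).
    exact: h.
  have h : continuous (fun s => bder B s * cos (s * l) - bval B s * sin (s * l)).
    exact: continuous_sub (continuous_mul cv cc) (continuous_mul cu cs).
  exact: h.
- split.
    have h : continuous (fun s => bval B s * bval C s).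
      exact: continuous_mul.
    exact: h.
  have h : continuous (fun s => bder B s * bval C s + bder C s * bval B s).
    exact: continuous_add (continuous_mul cv cu') (continuous_mul cv' cu).
  exact: h.
Qed.

Lemma bval_continuous B : continuous (bval B).
Proof. by have [] := bstate_continuous B. Qed.

Lemma bder_continuous B : continuous (bder B).
Proof. by have [] := bstate_continuous B. Qed.

Lemma secular_continuous A C : continuous (secular A C).
Proof.
have h : continuous (fun s => bval A s * bder C s + bder A s * bval C s).
  apply: continuous_add; apply: continuous_mul;
    first [exact: bval_continuous|exact: bder_continuous].
exact: h.
Qed.

(** The derivative of the cotangent is minus the Wronskian of [branch_derive] over the squared
    value. *)
Lemma ratio_nincr B s t : wf B -> s <= t ->
  (forall x, s <= x <= t -> bval B x != 0) ->
  bder B t / bval B t <= bder B s / bval B s.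
Proof.
move=> wB st nz; pose f x := bder B x / bval B x.
have df x : x \in `[s, t] -> exists2 d, is_derive x 1 f d & d <= 0.
  rewrite in_itv /= => /nz ux; have [du [dv [hu hv w _]]] := branch_derive x wB.
  eexists; first exact: (is_deriveM hv (is_deriveV ux hu)).
  rewrite /GRing.scale /=; set u := bval B x in ux w *; set v := bder B x in w *.
  have -> : v * (- u ^- 2 * du) + u^-1 * dv = - (du * v - dv * u) / u ^+ 2 by field.
  by rewrite mulNr oppr_le0 divr_ge0 ?sqr_ge0.
have cf : {within `[s, t], continuous f}.
  apply: derivable_within_continuous => x /df [d [hd _] _]; exact: hd.
apply: (@ler0_derive1_le_cc R f s t _ _ cf) => //.
- by move=> x /subset_itv_oo_cc/df [d [hd _] _]; exact: hd.
- by move=> x /subset_itv_oo_cc/df [d [hd hE] d0]; rewrite derive1E hE.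
- by rewrite in_itv /= lexx st.
- by rewrite in_itv /= lexx st.
Qed.

(** The cotangent stays below its value at [a]; multiply by the values and pass to the limit at [b].
    The conclusion is not strict because the state may degenerate at [b]. *)
Lemma bder_zero_left B a b : wf B -> a < b -> bval B b = 0 ->
  (forall x, a <= x < b -> bval B x != 0) -> bval B a * bder B b <= 0.
Proof.
move=> wB ab ub nz; set r := bder B a / bval B a.
have a_in : a <= a < b by rewrite lexx ab.
suff h : forall x, a <= x < b ->
    bval B a * bder B x <= bval B a * (r * bval B x).
  have := @le_at_right_end R (fun x => bval B a * bder B x)
    (fun x => bval B a * (r * bval B x)) a b.
  rewrite ub !mulr0; apply => //; apply: continuous_mul; try exact: cst_continuous.
    exact: bder_continuous.
  by apply: continuous_mul; [exact: cst_continuous|exact: bval_continuous].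
move=> x /andP[ax xb].
have := @ratio_nincr B a x wB ax; rewrite -/r => /(_ _) h.
have {}h : bder B x / bval B x <= r.
  by apply: h => y /andP[ay yx]; apply: nz; rewrite ay (le_lt_trans yx).
have sg : 0 < bval B a * bval B x.
  apply: nonzero_same_sign => //; first exact: bval_continuous.
  by move=> y /andP[ay yx]; apply: nz; rewrite ay (le_lt_trans yx).
have ux : bval B x != 0 by apply: nz; rewrite ax.
have -> : bder B x = bder B x / bval B x * bval B x by rewrite divfK.
by rewrite mulrCA [leRHS]mulrCA ler_wpM2r // ltW.
Qed.

Lemma bder_zero_right B a b : wf B -> a < b -> bval B a = 0 ->
  (forall x, a < x <= b -> bval B x != 0) -> 0 <= bval B b * bder B a.
Proof.
move=> wB ab ua nz; set r := bder B b / bval B b.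
suff h : forall x, a < x <= b ->
    bval B b * (r * bval B x) <= bval B b * bder B x.
  have := @le_at_left_end R (fun x => bval B b * (r * bval B x))
    (fun x => bval B b * bder B x) a b.
  rewrite ua !mulr0; apply => //; apply: continuous_mul; try exact: cst_continuous.
    by apply: continuous_mul; [exact: cst_continuous|exact: bval_continuous].
  exact: bder_continuous.
move=> x /andP[ax xb].
have h : r <= bder B x / bval B x.
  apply: ratio_nincr => // y /andP[xy yb]; apply: nz.
  by rewrite yb (lt_le_trans ax).
have sg : 0 < bval B b * bval B x.
  rewrite mulrC; apply: nonzero_same_sign => //; first exact: bval_continuous.
  by move=> y /andP[xy yb]; apply: nz; rewrite yb (lt_le_trans ax).
have ux : bval B x != 0 by apply: nz; rewrite xb ax.
have -> : bder B x = bder B x / bval B x * bval B x by rewrite divfK.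
by rewrite mulrCA [leRHS]mulrCA ler_wpM2r // ltW.
Qed.

Fixpoint blength B : R :=
  match B with
  | Edge l => l
  | Ext l B => blength B + l
  | Join B C => blength B + blength C
  end.

Lemma blength_gt0 B : wf B -> 0 < blength B.
Proof.
elim: B => [//|l B IH|B IHB C IHC] /=.
  by move=> [l0 /IH B0]; exact: addr_gt0.
by move=> [/IHB B0 /IHC C0]; exact: addr_gt0.
Qed.

(** The last clause bounds the angle by that of a single edge with the total length of the branch.
    At a vertex this is [cot x + cot y >= cot (x + y)] for positive [x], [y] with sum below
    [pi / 2]. *)
Lemma bstate_small B s : wf B -> 0 < s -> s * blength B < pi / 2 ->
  [/\ 0 < bval B s, 0 < bder B s &
      bval B s * cos (s * blength B) <= bder B s * sin (s * blength B)].
Proof.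
move=> + s0; have pi2 : pi / 2 < pi :> R by have := pi_gt0 R; lra.
elim: B => [l|l B IH|B IHB C IHC] /=.
- move=> l0 sl; rewrite !bE; have sl0 : 0 < s * l by exact: mulr_gt0.
  split; [|apply: cos_gt0_pihalf|by rewrite mulrC].
    by apply: sin_gt0_pi; rewrite sl0 (lt_trans sl).
  by rewrite sl andbT; have := pi_gt0 R; lra.
- move=> [l0 wB] sl; have L0 := mulr_gt0 s0 (blength_gt0 wB).
  have sl0 := mulr_gt0 s0 l0; rewrite mulrDr in sl.
  have [|u0 v0 h] := IH wB; first lra.
  have cL : 0 < cos (s * blength B) by apply: cos_gt0_pihalf; lra.
  have cl : 0 < cos (s * l) by apply: cos_gt0_pihalf; lra.
  have dl : 0 < sin (s * l) by apply: sin_gt0_pi; rewrite sl0; lra.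
  have cLl : 0 < cos (s * blength B + s * l) by apply: cos_gt0_pihalf; lra.
  rewrite !bE mulrDr; split.
  + by rewrite addr_gt0 // mulr_gt0.
  + rewrite -(pmulr_lgt0 _ cL); rewrite cosD in cLl.
    move: h cLl u0 v0 dl; move: (bval B s) (bder B s) (cos (s * l)) (sin (s * l))
      (cos (s * blength B)) (sin (s * blength B)) => u v c d cc dd h cLl u0 v0 d0.
    have h1 : 0 < v * (cc * c - dd * d) by exact: mulr_gt0.
    have h2 : u * cc * d <= v * dd * d by rewrite ler_pM2r.
    nra.
  + rewrite sinD cosD -subr_ge0.
    have -> : forall u v c d C D : R, (v * c - u * d) * (D * c + C * d) -
        (u * c + v * d) * (C * c - D * d) = (v * D - u * C) * (c ^+ 2 + d ^+ 2).
      by move=> *; ring.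
    by rewrite cos2Dsin2 mulr1 subr_ge0.
- move=> [wB wC]; have B0 := mulr_gt0 s0 (blength_gt0 wB).
  have C0 := mulr_gt0 s0 (blength_gt0 wC); rewrite mulrDr => sl.
  have [|u0 v0 h] := IHB wB; first lra.
  have [|u0' v0' h'] := IHC wC; first lra.
  have cB : 0 < cos (s * blength B) by apply: cos_gt0_pihalf; lra.
  have cC : 0 < cos (s * blength C) by apply: cos_gt0_pihalf; lra.
  have dB : 0 < sin (s * blength B) by apply: sin_gt0_pi; lra.
  have dC : 0 < sin (s * blength C) by apply: sin_gt0_pi; lra.
  rewrite !bE; split; [exact: mulr_gt0|by rewrite addr_gt0 ?mulr_gt0|].
  rewrite sinD cosD; move: u0 v0 u0' v0' h h' cB cC dB dC.
  move: (bval B s) (bder B s) (bval C s) (bder C s) (cos (s * blength B))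
    (sin (s * blength B)) (cos (s * blength C)) (sin (s * blength C)).
  move=> u v u' v' c d c' d' u0 v0 u0' v0' h h' c0 c0' d0 d0'.
  have h1 : u' * (u * c) * c' <= u' * (v * d) * c' by rewrite ler_pM2r // ler_pM2l.
  have h2 : 0 < u * u' * (d * d') by rewrite !mulr_gt0.
  have h3 : 0 < v * u' * (c * d') by rewrite !mulr_gt0.
  have h4 : 0 < v' * u * (d * c' + c * d') by rewrite !mulr_gt0 // addr_gt0 ?mulr_gt0.
  nra.
Qed.

Lemma bstate_near0 B : wf B -> exists2 e, 0 < e &
  forall s, 0 < s -> s < e -> 0 < bval B s /\ 0 < bder B s.
Proof.
move=> wB; have L0 := blength_gt0 wB; exists (pi / 2 / blength B).
  by rewrite !divr_gt0 ?pi_gt0.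
move=> s s0; rewrite ltr_pdivlMr // => h.
by have [] := bstate_small wB s0 h.
Qed.

End BranchStates.

(** * Positivity of all branches up to the ground frequency *)

Section Positivity.
Variable R : realType.
Implicit Types (A B C : branch R) (k l s t x y : R).

Lemma pos_before_zero (f : R -> R) b : continuous f ->
  (exists2 e, 0 < e & forall s, 0 < s -> s < e -> 0 < f s) ->
  (forall s, 0 < s < b -> f s != 0) -> forall s, 0 < s < b -> 0 < f s.
Proof.
move=> cf [e e0 he] nz s /andP[s0 sb]; pose t := Num.min s (e / 2).
have t0 : 0 < t by rewrite lt_min s0 divr_gt0.
have te : t < e by rewrite gt_min [X in _ || X]ltr_pdivrMr // ltr_pMr // ltr1n orbT.
have ts : t <= s by rewrite ge_min lexx.
rewrite -(pmulr_rgt0 _ (he t t0 te)); apply: nonzero_same_sign => // x /andP[tx xs].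
by rewrite nz // (lt_le_trans t0 tx) (le_lt_trans xs sb).
Qed.

Lemma zero_if_neg (f : R -> R) b : continuous f ->
  (exists2 e, 0 < e & forall s, 0 < s -> s < e -> 0 < f s) ->
  0 < b -> f b < 0 -> exists2 s, 0 < s < b & f s = 0.
Proof.
move=> cf [e e0 he] b0 fb; pose t := Num.min (b / 2) (e / 2).
have t0 : 0 < t by rewrite lt_min !divr_gt0.
have te : t < e by rewrite gt_min [X in _ || X]ltr_pdivrMr // ltr_pMr // ltr1n orbT.
have tb : t < b by rewrite gt_min ltr_pdivrMr // ltr_pMr // ltr1n.
have [|s /andP[ts sb] fs] := IVT_zero cf tb; first by rewrite pmulr_rlt0 ?he.
by exists s => //; rewrite sb (lt_trans t0).
Qed.

Lemma first_zero_pos (f : R -> R) b : continuous f ->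
  (exists2 e, 0 < e & forall s, 0 < s -> s < e -> 0 < f s) ->
  0 < b -> f b = 0 -> exists c, [/\ 0 < c <= b, f c = 0 &
    forall s, 0 < s < c -> 0 < f s].
Proof.
move=> cf [e e0 he] b0 fb; pose t := Num.min (b / 2) (e / 2).
have t0 : 0 < t by rewrite lt_min !divr_gt0.
have te : t < e by rewrite gt_min [X in _ || X]ltr_pdivrMr // ltr_pMr // ltr1n orbT.
have tb : t <= b by rewrite ge_min ler_pdivrMr // ler_pMr // ler1n.
have [c [/andP[tc cb] fc nz]] := first_zero cf fb tb.
have tc' : t < c.
  rewrite lt_neqAle tc andbT; apply/eqP => E.
  by have := he t t0 te; rewrite E fc ltxx.
exists c; split => //; first by rewrite cb (lt_trans t0).
apply: pos_before_zero => //; first by exists e.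
move=> s /andP[s0 sc]; case: (ltP s t) => st.
  by rewrite gt_eqF // he // (lt_trans st).
by rewrite nz // st.
Qed.

Lemma bval_near0 B (wB : wf B) : exists2 e, 0 < e &
  forall s, 0 < s -> s < e -> 0 < bval B s.
Proof.
by have [e e0 he] := bstate_near0 wB; exists e => // s s0 /(he s s0)[].
Qed.

Lemma bder_first_zero B c : wf B -> 0 < c -> bval B c = 0 ->
  (forall s, 0 < s < c -> 0 < bval B s) -> bder B c <= 0.
Proof.
move=> wB c0 uc up; have h2 : 0 < c / 2 < c.
  by rewrite divr_gt0 // ltr_pdivrMr // ltr_pMr // ltr1n.
rewrite -(pmulr_rle0 _ (up _ h2)); move/andP: h2 => [h0 h2].
apply: bder_zero_left => // x /andP[cx xc]; rewrite gt_eqF // up // xc.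
by rewrite (lt_le_trans h0).
Qed.

(** A longer stem increases the angle, so the first zero can only move to a lower frequency. *)
Lemma Ext_zero l B b : 0 < l -> wf B ->
  (exists2 s, 0 < s < b & bval B s = 0) ->
  exists2 s, 0 < s < b & bval (Ext l B) s = 0.
Proof.
move=> l0 wB [z /andP[z0 zb] uz].
have [c [/andP[c0 cz] uc up]] := first_zero_pos (@bval_continuous _ _) (bval_near0 wB) z0 uz.
have vc := bder_first_zero wB c0 uc up.
have cb : c < b by exact: le_lt_trans zb.
suff [s /andP[s0 sc] us] : exists2 s, 0 < s <= c & bval (Ext l B) s <= 0.
  have wE : wf (Ext l B) by [].
  have [us0|us0] := eqVneq (bval (Ext l B) s) 0.
    by exists s => //; rewrite s0 (le_lt_trans sc).
  have [||t /andP[t0 ts] ut] := @zero_if_neg (bval (Ext l B)) s _ (bval_near0 wE) s0.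
  - exact: bval_continuous.
  - by rewrite lt_neqAle us0.
  - by exists t => //; rewrite t0 (lt_trans ts) // (le_lt_trans sc).
(* At the first zero [c] of [B] only the sine term survives, multiplied by a slope that is not
   positive. If [c * l] is too large for a positive sine, the frequency [pi / l], at which the edge
   reverses the sign of the value, takes the place of [c]. *)
have [cl|cl] := ltP (c * l) pi.
  exists c; first by rewrite c0 lexx.
  rewrite bE uc mul0r add0r mulr_le0_ge0 // ltW // sin_gt0_pi // cl andbT.
  exact: mulr_gt0.
have p0 : 0 < pi / l by rewrite divr_gt0 // pi_gt0.
have pc : pi / l <= c by rewrite ler_pdivrMr.
exists (pi / l); first by rewrite p0.
rewrite bE divfK ?gt_eqF // cospi sinpi mulr0 addr0 mulrN1 oppr_le0.
move: pc; rewrite le_eqVlt => /predU1P[->|pc]; first by rewrite uc.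
by rewrite ltW // up // p0.
Qed.

(** Positivity is demanded at the root end of every edge inside the branch, so that sub-branches
    inherit it; the frequency [k] is included. *)
Fixpoint pos k B : Prop :=
  match B with
  | Edge l => forall s, 0 < s <= k -> 0 < bval (Edge l) s
  | Ext l B => (forall s, 0 < s <= k -> 0 < bval (Ext l B) s) /\ pos k B
  | Join B C => pos k B /\ pos k C
  end.

Lemma pos_bval k B : pos k B -> forall s, 0 < s <= k -> 0 < bval B s.
Proof.
elim: B => [//|l B IH [] //|B IHB C IHC [/IHB hB /IHC hC] s sk].
by rewrite bE mulr_gt0 ?hB ?hC.
Qed.

(* At a first common zero [c] both slopes are controlled by the monotone
   ratios, which forces a degenerate state. *)
Lemma secular_pos_degenerate A C c : wf A -> wf C -> 0 < c ->
  (forall s, 0 < s < c -> 0 < bval A s) ->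
  (forall s, 0 < s < c -> 0 < bval C s) ->
  (forall s, 0 < s < c -> 0 < secular A C s) ->
  bval A c = 0 -> bder A c = 0.
Proof.
move=> wA wC c0 uA uC DAC uAc; apply/eqP; rewrite eq_le (bder_first_zero wA c0 uAc uA) /=.
have h2 : 0 < c / 2 < c by rewrite divr_gt0 // ltr_pdivrMr // ltr_pMr // ltr1n.
set a := c / 2 in h2; pose r := bder C a / bval C a.
have := @le_at_right_end R (fun x => - r * bval A x) (bder A) a c.
rewrite uAc mulr0; apply.
- by apply: continuous_mul; [exact: cst_continuous|exact: bval_continuous].
- exact: bder_continuous.
- by case/andP: h2.
move=> x /andP[ax xc]; have x0 : 0 < x < c by rewrite xc (lt_le_trans _ ax) //; case/andP: h2.
have rx : bder C x / bval C x <= r.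
  apply: ratio_nincr => // y /andP[ay yx]; rewrite gt_eqF // uC //.
  by rewrite (le_lt_trans yx xc) (lt_le_trans _ ay) //; case/andP: h2.
have uCx := uC x x0; have uAx := uA x x0; have := DAC x x0; rewrite /secular.
rewrite ler_pdivrMr // in rx.
have h : bval A x * bder C x <= bval A x * (r * bval C x) by rewrite ler_pM2l.
move=> D; rewrite -(ler_pM2r uCx); lra.
Qed.

(** At the first zero of the product of both values the vanishing side would have state (0, 0), and
    the secular function would vanish before [k]. *)
Lemma secular_bval_pos A C k : wf A -> wf C ->
  (forall s, 0 < s < k -> 0 < secular A C s) ->
  forall s, 0 < s < k -> 0 < bval A s.
Proof.
move=> wA wC D s sk; rewrite ltNge; apply/negP => us.
pose f x := bval A x * bval C x.
have cf : continuous f by apply: continuous_mul; exact: bval_continuous.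
have f0 : exists2 e, 0 < e & forall s, 0 < s -> s < e -> 0 < f s.
  have [e e0 he] := bval_near0 wA; have [d d0 hd] := bval_near0 wC.
  exists (Num.min e d); first by rewrite lt_min e0.
  by move=> x x0; rewrite lt_min => /andP[/he-/(_ x0) h1 /hd-/(_ x0) h2]; rewrite mulr_gt0.
have [z /andP[z0 zs] uz] : exists2 z, 0 < z <= s & bval A z = 0.
  have /andP[s0 _] := sk.
  move: us; rewrite le_eqVlt => /predU1P[us|us]; first by exists s; rewrite ?s0 ?lexx.
  have [||t /andP[t0 ts] ut] := @zero_if_neg (bval A) s _ (bval_near0 wA) s0 => //.
    exact: bval_continuous.
  by exists t; rewrite // t0 ltW.
have fz : f z = 0 by rewrite /f uz mul0r.
have [c [/andP[c0 cz] fc fp]] := first_zero_pos cf f0 z0 fz.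
have /andP[_ sk2] := sk; have ck : c < k by exact: le_lt_trans (le_trans cz zs) sk2.
have part B (wB : wf B) : (forall s, 0 < s < c -> bval B s != 0) ->
    forall s, 0 < s < c -> 0 < bval B s.
  by apply: pos_before_zero => //; [exact: bval_continuous|exact: bval_near0].
have pA : forall s, 0 < s < c -> 0 < bval A s.
  by apply: part => // x /fp; apply: contraTneq; rewrite /f => ->; rewrite mul0r ltxx.
have pC : forall s, 0 < s < c -> 0 < bval C s.
  by apply: part => // x /fp; apply: contraTneq; rewrite /f => ->; rewrite mulr0 ltxx.
have Dc : forall s, 0 < s < c -> 0 < secular A C s.
  by move=> x /andP[x0 xc]; apply: D; rewrite x0 (lt_trans xc).
have DcC : forall s, 0 < s < c -> 0 < secular C A s.
  by move=> x xc; rewrite secularC Dc.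
have := D c; rewrite c0 ck /secular => /(_ isT).
move/eqP: fc; rewrite mulf_eq0 => /orP[/eqP u|/eqP u].
  by rewrite (secular_pos_degenerate wA wC c0 pA pC Dc u) u !mul0r addr0 ltxx.
by rewrite (secular_pos_degenerate wC wA c0 pC pA DcC u) u !mulr0 addr0 ltxx.
Qed.

(** Induction on [A] with [C] general: each step hands an edge or a joined branch over to the other
    side of the cut. At [k] itself a zero would again be degenerate, which is impossible at the end
    of an edge, where the state is a rotated nonzero state. *)
Lemma secular_pos A C k : 0 < k -> wf A -> wf C ->
  (forall s, 0 < s < k -> 0 < secular A C s) -> pos k A.
Proof.
move=> k0; elim: A C => [l|l A IH|A IHA B IHB] C wA wC D.
- move=> s /andP[s0]; rewrite le_eqVlt => /predU1P[->|sk]; last first.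
    by apply: (secular_bval_pos wA wC D); rewrite s0.
  have uA := secular_bval_pos wA wC D.
  have uC : forall s, 0 < s < k -> 0 < bval C s.
    by apply: (@secular_bval_pos C (Edge l)) => // x xk; rewrite secularC D.
  have : 0 <= bval (Edge l) k.
    apply: (@le_at_right_end R (cst 0) _ (k / 2)); first exact: cst_continuous.
    - exact: bval_continuous.
    - by rewrite ltr_pdivrMr // ltr_pMr // ltr1n.
    - move=> x /andP[kx xk]; rewrite ltW // uA // xk (lt_le_trans _ kx) //.
      by rewrite divr_gt0.
  rewrite le_eqVlt => /predU1P[/esym u|//].
  have v := secular_pos_degenerate wA wC k0 uA uC D u.
  have := cos2Dsin2 (k * l); rewrite -bval_Edge -bder_Edge u v expr0n /= addr0.
  by move/eqP; rewrite eq_sym oner_eq0.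
- have [l0 wA'] := wA.
  have pA' : pos k A.
    by apply: (IH (Ext l C)) => // s sk; rewrite -secular_Ext D.
  split=> // s /andP[s0]; rewrite le_eqVlt => /predU1P[->|sk]; last first.
    by apply: (secular_bval_pos wA wC D); rewrite s0.
  have uA := secular_bval_pos wA wC D.
  have uC : forall s, 0 < s < k -> 0 < bval C s.
    by apply: (@secular_bval_pos C (Ext l A)) => // x xk; rewrite secularC D.
  have : 0 <= bval (Ext l A) k.
    apply: (@le_at_right_end R (cst 0) _ (k / 2)); first exact: cst_continuous.
    - exact: bval_continuous.
    - by rewrite ltr_pdivrMr // ltr_pMr // ltr1n.
    - move=> x /andP[kx xk]; rewrite ltW // uA // xk (lt_le_trans _ kx) //.
      by rewrite divr_gt0.
  rewrite le_eqVlt => /predU1P[/esym u|//].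
  have v := secular_pos_degenerate wA wC k0 uA uC D u.
  have := norm_Ext l A k; rewrite u v expr0n /= addr0 => /esym/eqP.
  have uk : 0 < bval A k by apply: (pos_bval pA'); rewrite k0 lexx.
  by rewrite gt_eqF // ltr_pwDl ?sqr_ge0 // exprn_gt0.
- have [wA1 wB] := wA; split.
    by apply: (IHA (Join B C)) => // s sk; rewrite -secular_Join D.
  by apply: (IHB (Join A C)) => // s sk; rewrite -secular_JoinC D.
Qed.

End Positivity.

(** * Comparison of the states at [k] and at [2 * k] *)

Section AngleDoubling.
Variable R : realType.
Implicit Types (A B C : branch R) (k l s t x y : R).

Fixpoint is_chain B : bool :=
  match B with
  | Edge _ => true
  | Ext _ B => is_chain B
  | Join _ _ => false
  end.

Definition is_join B : bool := if B is Join _ _ then true else false.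

Lemma chainE B s : is_chain B -> bval B s = sin (s * blength B) /\ bder B s = cos (s * blength B).
Proof.
elim: B => [l|l B IH|//] //= /IH [hu hv]; rewrite !bE hu hv mulrDr sinD cosD.
by split; ring.
Qed.

(** The extremal shape of one side of the cut: together with [pos k] it means unbranched paths, each
    of length [pi / (2 * k)], meeting at the root. *)
Fixpoint flat k B : Prop :=
  match B with
  | Join B C => flat k B /\ flat k C
  | _ => is_chain B /\ bder B k = 0
  end.

Lemma chain_flat k B : is_chain B -> bder B k = 0 -> flat k B.
Proof. by case: B. Qed.

(** Where the values are positive, this says without division that the cotangent tends to minus
    infinity as [s] increases to [b], so that the angle reaches [pi] at [b]. *)
Definition ratio_to_Noo B b := forall K, exists a,
  0 < a < b /\ forall s, a <= s < b -> bder B s <= K * bval B s.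

Lemma ratio_to_Noo_zero B b : 0 < b -> bval B b = 0 -> bder B b < 0 -> ratio_to_Noo B b.
Proof.
move=> b0 ub vb K.
have [||e e0 he] := @pos_near R (fun s => K * bval B s - bder B s) b.
- suff: continuous (fun s => K * bval B s - bder B s) by apply.
  apply: continuous_sub; last exact: bder_continuous.
  by apply: continuous_mul; [exact: cst_continuous|exact: bval_continuous].
- by rewrite ub mulr0 sub0r oppr_gt0.
pose a := Num.max (b / 2) (b - e / 2).
have h2 : 0 < b / 2 by rewrite divr_gt0.
have e2 : 0 < e / 2 by rewrite divr_gt0.
have ab : a < b by rewrite gt_max; apply/andP; split; lra.
exists a; rewrite ab lt_max h2 /=; split => // s /andP[].
rewrite ge_max => /andP[h3 h4] sb; rewrite -subr_ge0 ltW // he //.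
rewrite ger0_norm; lra.
Qed.

(* For states [r (sin a, cos a)] at [k] and [r' (sin a', cos a')] at [2 k] this is
   [r ^ 2 r' sin (a' - 2 a)]. *)
Definition doubling_gap k B :=
  bval B (2 * k) * (bder B k ^+ 2 - bval B k ^+ 2) -
  2 * (bval B k * bder B k * bder B (2 * k)).

(** The edge adds [k * l] to the angle at [k] and twice as much to the angle at [2 * k], so
    [a' - 2 a] does not change. *)
Lemma doubling_gap_Ext k l B : doubling_gap k (Ext l B) = doubling_gap k B.
Proof.
transitivity (doubling_gap k B * (cos (k * l) ^+ 2 + sin (k * l) ^+ 2) ^+ 2).
  rewrite /doubling_gap !bE.
  have -> : 2 * k * l = k * l + k * l by ring.
  rewrite sinD cosD; ring.
by rewrite cos2Dsin2 expr1n mulr1.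
Qed.

Lemma doubling_gap_Edge k l : doubling_gap k (Edge l) = 0.
Proof.
rewrite /doubling_gap !bE.
have -> : 2 * k * l = k * l + k * l by ring.
by rewrite sinD cosD; ring.
Qed.

Lemma doubling_gap_chain k B : is_chain B -> doubling_gap k B = 0.
Proof.
elim: B => [l|l B IH|//] //= h; first exact: doubling_gap_Edge.
by rewrite doubling_gap_Ext IH.
Qed.

(* cot 2x = (cot x - 1 / cot x) / 2, so the gap for a join comes from
   1/c + 1/c' > 1/(c + c') *)
Lemma doubling_gap_Join k B C :
  0 < bval B k -> 0 < bval C k -> 0 < bder B k -> 0 < bder C k ->
  0 < bval B (2 * k) -> 0 < bval C (2 * k) ->
  0 <= doubling_gap k B -> 0 <= doubling_gap k C -> 0 < doubling_gap k (Join B C).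
Proof.
rewrite /doubling_gap !bE.
move: (bval B k) (bval C k) (bder B k) (bder C k) (bval B (2 * k))
  (bval C (2 * k)) (bder B (2 * k)) (bder C (2 * k)).
move=> u u' v v' U U' V V' u0 u0' v0 v0' U0 U0' h h'.
set w := v * u' + v' * u; have w0 : 0 < w by rewrite addr_gt0 ?mulr_gt0.
rewrite -(pmulr_rgt0 _ (mulr_gt0 v0 v0')).
have -> : v * v' * (U * U' * (w ^+ 2 - (u * u') ^+ 2) -
    2 * (u * u' * w * (V * U' + V' * U))) =
  (u' * v' * U' * w) * (U * (v ^+ 2 - u ^+ 2) - 2 * (u * v * V)) +
  (u * v * U * w) * (U' * (v' ^+ 2 - u' ^+ 2) - 2 * (u' * v' * V')) +
  U * U' * (u * u') * ((v * u') ^+ 2 + (v' * u) ^+ 2 + v * u' * (v' * u))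
  by rewrite /w; ring.
apply: ltr_wpDl; first by rewrite addr_ge0 // mulr_ge0 // !mulr_ge0 ?ltW.
by rewrite !mulr_gt0 // ltr_wpDl ?addr_ge0 ?sqr_ge0 // !mulr_gt0.
Qed.

(* Unless [B] has a Dirichlet zero below [2 k], the angle of its state at [2 k]
   is at least twice the one at [k], with equality only for chains. *)
Definition doubled k B :=
  [/\ 0 <= bder B k, bder B k = 0 -> flat k B &
   ratio_to_Noo B (2 * k) \/
   [/\ 0 < bder B k, 0 < bval B (2 * k), 0 <= doubling_gap k B &
       is_chain B \/ 0 < doubling_gap k B]].

Definition zero_below B b := exists2 s, 0 < s < b & bval B s = 0.

Lemma no_zero_pos B b : wf B -> ~ zero_below B b ->
  forall s, 0 < s < b -> 0 < bval B s.
Proof.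
move=> wB nz; apply: pos_before_zero; [exact: bval_continuous|exact: bval_near0|].
by move=> s sb; apply/eqP => us; apply: nz; exists s.
Qed.

(** The angle of a chain is [k * L] exactly; the three cases compare it with [pi / 2]. *)
Lemma doubling_chain k B : 0 < k -> wf B -> is_chain B -> pos k B ->
  zero_below B (2 * k) \/ doubled k B.
Proof.
move=> k0 wB cB pB; set L := blength B; have L0 : 0 < L := blength_gt0 wB.
have hu s : bval B s = sin (s * L) by case: (chainE s cB).
have hv s : bder B s = cos (s * L) by case: (chainE s cB).
have kL0 : 0 < k * L by exact: mulr_gt0.
have kpi : k * L < pi.
  rewrite ltNge; apply/negP => h; have := @pos_bval _ _ _ pB (pi / L).
  by rewrite hu divfK ?gt_eqF // sinpi ltxx divr_gt0 ?pi_gt0 // ler_pdivrMr // h => /(_ isT).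
have two : 2 * k * L = k * L + k * L by ring.
have [h|h|h] := ltrgtP (k * L) (pi / 2).
- right; have c0 : 0 < cos (k * L) by apply: cos_gt0_pihalf; rewrite h andbT; lra.
  have s0 : 0 < sin (k * L) by apply: sin_gt0_pi; rewrite kL0.
  split; rewrite hv; [exact: ltW|by move=> E; rewrite E ltxx in c0|right].
  split => //; first by rewrite hu two sinD addr_gt0 ?mulr_gt0.
    by rewrite doubling_gap_chain.
  by left.
- left; exists (pi / L); last by rewrite hu divfK ?gt_eqF // sinpi.
  by rewrite divr_gt0 ?pi_gt0 // ltr_pdivrMr //; lra.
- right; have c0 : bder B k = 0 by rewrite hv h cos_pihalf.
  split; rewrite ?c0 //; first by move=> _; exact: chain_flat.
  left; apply: ratio_to_Noo_zero; first exact: mulr_gt0.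
    by rewrite hu two h -splitr sinpi.
  by rewrite hv two h -splitr cospi oppr_lt0.
Qed.

Lemma Ext_Ext x y B s : bval (Ext x (Ext y B)) s = bval (Ext (y + x) B) s /\
  bder (Ext x (Ext y B)) s = bder (Ext (y + x) B) s.
Proof. by rewrite !bE mulrDr sinD cosD; split; ring. Qed.

Lemma zero_below_Ext_le x y B b : 0 < x <= y -> wf B ->
  zero_below (Ext x B) b -> zero_below (Ext y B) b.
Proof.
move=> /andP[x0]; rewrite le_eqVlt => /predU1P[->//|xy] wB z.
have [||s sb us] := @Ext_zero _ (y - x) (Ext x B) b _ _ z; rewrite ?subr_gt0 //.
by exists s => //; have [E _] := Ext_Ext (y - x) x B s; rewrite subrKC us in E.
Qed.

(** Locates a stationary point on the edge: the frequency is fixed and the intermediate value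
    theorem is applied to the position [y]. *)
Lemma rotate_to_zero k l B : 0 < l -> 0 < bder B k -> bder (Ext l B) k <= 0 ->
  exists2 y, 0 < y <= l & bder (Ext y B) k = 0.
Proof.
move=> l0 v0; rewrite le_eqVlt => /predU1P[vl|vl]; first by exists l; rewrite ?l0 ?lexx.
pose g (y : R) := bder B k * cos (y * k) - bval B k * sin (y * k).
have gE y : g y = bder (Ext y B) k by rewrite bE /g mulrC [y * k]mulrC mulrC.
have cg : continuous g.
  apply: continuous_sub; apply: continuous_mul; try exact: cst_continuous.
    exact: continuous_cosM.
  exact: continuous_sinM.
have [|y /andP[y0 yl] gy] := IVT_zero cg l0.
  rewrite nmulr_llt0; last by rewrite gE.
  by rewrite /g !mul0r cos0 sin0 mulr1 mulr0 subr0.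
by exists y; rewrite ?y0 ?ltW // -gE.
Qed.

(** The angle of [B] tends to [pi], so any additional edge pushes it past [pi] before [b]. *)
Lemma ratio_to_Noo_Ext l B b : 0 < l -> 0 < b -> wf B ->
  (forall s, 0 < s < b -> 0 < bval B s) -> ratio_to_Noo B b ->
  zero_below (Ext l B) b.
Proof.
(* A short piece of the edge suffices, and its own angle stays below [pi] up to [b], which keeps the
   sines positive. *)
move=> l0 b0 wB uB oo; pose y := Num.min l (pi / 2 / b).
have y0 : 0 < y by rewrite lt_min l0 !divr_gt0 ?pi_gt0.
have yl : y <= l by rewrite ge_min lexx.
have by_lt : b * y < pi.
  have : y <= pi / 2 / b by rewrite ge_min lexx orbT.
  by rewrite ler_pdivlMr // mulrC; have := pi_gt0 R; lra.
apply: (@zero_below_Ext_le y) => //; first by rewrite y0.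
have d0 : 0 < sin (b * y) by rewrite sin_gt0_pi // by_lt mulr_gt0.
(* With this [K] the quantity [- K * sin - cos] equals 1 at [b], hence is positive shortly
   before. *)
pose K := - ((cos (b * y) + 1) / sin (b * y)).
have [||e e0 he] := @pos_near R (fun s => - K * sin (s * y) - cos (s * y)) b.
- suff: continuous (fun s => - K * sin (s * y) - cos (s * y)) by apply.
  apply: continuous_sub; last exact: continuous_cosM.
  by apply: continuous_mul; [exact: cst_continuous|exact: continuous_sinM].
- by rewrite /K opprK divfK ?gt_eqF //; lra.
have [a [/andP[a0 ab] ha]] := oo K.
pose s := Num.max a (b - e / 2).
have e2 : 0 < e / 2 by rewrite divr_gt0.
have sb : s < b by rewrite gt_max ab; lra.
have sa : a <= s by rewrite le_max lexx.
have s0 : 0 < s by exact: lt_le_trans sa.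
have se : b - e / 2 <= s by rewrite le_max lexx orbT.
have us : bval (Ext y B) s < 0.
  have := he s; rewrite ger0_norm ?subr_ge0 ?(ltW sb) // => /(_ _) h.
  have {}h : 0 < - K * sin (s * y) - cos (s * y) by apply: h; lra.
  have v := ha s; rewrite sa sb in v; have {}v := v isT.
  have d : 0 < sin (s * y).
    by rewrite sin_gt0_pi // mulr_gt0 //= (lt_trans _ by_lt) // ltr_pM2r.
  have u : 0 < bval B s by rewrite uB // s0.
  rewrite bE; have h1 : bder B s * sin (s * y) <= K * bval B s * sin (s * y) by rewrite ler_pM2r.
  have h2 : 0 < bval B s * (- K * sin (s * y) - cos (s * y)) by exact: mulr_gt0.
  lra.
have wE : wf (Ext y B) by [].
have [||t /andP[t0 ts] ut] := @zero_if_neg _ (bval (Ext y B)) s _ (bval_near0 wE) s0 => //.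
  exact: bval_continuous.
by exists t => //; rewrite t0 (lt_trans ts).
Qed.

Lemma doubling_alternative k B : 0 < k -> wf B -> pos k B ->
  zero_below B (2 * k) \/ doubled k B.
Proof.
move=> k0; have k2 : 0 < 2 * k by exact: mulr_gt0.
have kk : 0 < k <= k by rewrite k0 lexx.
elim: B => [l|l B IH|B IHB C IHC] wB pB.
- exact: doubling_chain.
- have [cB|ncB] := boolP (is_chain (Ext l B)); first exact: doubling_chain.
  have [l0 wB'] := wB; have [pE pB'] := pB.
  have [zB|dB] := IH wB' pB'; first by left; exact: Ext_zero.
  have [nz|nz] := pselect (zero_below (Ext l B) (2 * k)); first by left.
  have [nzB|nzB] := pselect (zero_below B (2 * k)); first by left; exact: Ext_zero.
  have pEx := no_zero_pos wB nz; have pBx := no_zero_pos wB' nzB.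
  have Eneg : bval (Ext l B) (2 * k) < 0 -> False.
    move=> h; apply: nz; apply: zero_if_neg => //; first exact: bval_continuous.
    exact: bval_near0.
  have [v0 _ [b|[v0' U0 X0 X]]] := dB.
    by left; exact: ratio_to_Noo_Ext.
  (* [Ext l B] is not a chain, hence neither is [B], and the gap is strict. *)
  have {}X : 0 < doubling_gap k B by case: X => // cB; case/negP: ncB.
  have [vE|vE] := ltP 0 (bder (Ext l B) k); last first.
    (* At the stationary point the gap reduces to minus the value at [2 * k] times the squared value
       at [k]; being positive, it makes the value at [2 * k] negative. *)
    left; have [y /andP[y0 yl] vy] := rotate_to_zero l0 v0' vE.
    apply: (@zero_below_Ext_le y) => //; first by rewrite y0.
    have wy : wf (Ext y B) by [].
    apply: zero_if_neg => //; [exact: bval_continuous|exact: bval_near0|].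
    move: X; rewrite -(doubling_gap_Ext k y) /doubling_gap vy.
    rewrite mulr0 mul0r mulr0 subr0 expr0n /= sub0r mulrN oppr_gt0.
    by apply: contraTT; rewrite -!leNgt => h; rewrite mulr_ge0 ?sqr_ge0.
  right; split; [exact: ltW|by move=> E; rewrite E ltxx in vE|].
  have [UE|UE|UE] := ltrgtP 0 (bval (Ext l B) (2 * k)).
  + by right; rewrite !doubling_gap_Ext; split => //; right.
  + by case: (Eneg UE).
  (* As the value at [2 * k] is 0, the positive gap is a positive multiple of minus the slope
     there. *)
  + left; apply: ratio_to_Noo_zero => //.
    move: X; rewrite -(doubling_gap_Ext k l) /doubling_gap -UE mul0r sub0r oppr_gt0.
    rewrite pmulr_rlt0 // pmulr_rlt0 //; apply: mulr_gt0 => //; exact: pE.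
- have [wB1 wC] := wB; have [pB1 pC] := pB.
  have zJ : zero_below B (2 * k) \/ zero_below C (2 * k) -> zero_below (Join B C) (2 * k).
    by case=> -[s s0 us]; exists s => //; rewrite bE us ?(mulr0, mul0r).
  have [zB|[v0 fv alt]] := IHB wB1 pB1; first by left; apply: zJ; left.
  have [zC|[v0' fv' alt']] := IHC wC pC; first by left; apply: zJ; right.
  have [zB|nzB] := pselect (zero_below B (2 * k)); first by left; apply: zJ; left.
  have [zC|nzC] := pselect (zero_below C (2 * k)); first by left; apply: zJ; right.
  have uB := no_zero_pos wB1 nzB; have uC := no_zero_pos wC nzC.
  have uBk := pos_bval pB1 kk; have uCk := pos_bval pC kk.
  right; split; rewrite ?bE.
  + by rewrite addr_ge0 // mulr_ge0 // ltW.
  + move/eqP; rewrite paddr_eq0 ?mulr_ge0 ?(ltW uBk) ?(ltW uCk) // !mulf_eq0.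
    rewrite (gt_eqF uBk) (gt_eqF uCk) !orbF => /andP[/eqP/fv fB /eqP/fv' fC].
    by split.
  (* One cotangent tends to minus infinity while the other, from [k] on, is bounded above by its
     value at [k]; hence so does their sum. *)
  + have join_oo B1 C1 : wf B1 -> wf C1 ->
      (forall s, 0 < s < 2 * k -> 0 < bval B1 s) ->
      (forall s, 0 < s < 2 * k -> 0 < bval C1 s) ->
      ratio_to_Noo B1 (2 * k) -> forall K, exists a, 0 < a < 2 * k /\
        forall s, a <= s < 2 * k -> bder B1 s * bval C1 s + bder C1 s * bval B1 s
          <= K * (bval B1 s * bval C1 s).
      move=> wB2 wC2 uB1 uC1 oo K; pose r := bder C1 k / bval C1 k.
      have [a [/andP[a0 ak] ha]] := oo (K - r).
      exists (Num.max a k); split; first by rewrite lt_max a0 gt_max ak /=; lra.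
      move=> s /andP[]; rewrite ge_max => /andP[as_ ks] s2.
      have s0 : 0 < s < 2 * k by rewrite s2 (lt_le_trans k0).
      have := ha s; rewrite as_ s2 => /(_ isT) h1.
      have h2 : bder C1 s <= r * bval C1 s.
        rewrite -ler_pdivrMr ?uC1 //; apply: ratio_nincr => // x /andP[kx xs].
        by rewrite gt_eqF // uC1 // (lt_le_trans k0 kx) (le_lt_trans xs).
      have := uB1 s s0; have := uC1 s s0 => c0 b0.
      have h3 : bder B1 s * bval C1 s <= (K - r) * bval B1 s * bval C1 s by rewrite ler_pM2r.
      have h4 : bder C1 s * bval B1 s <= r * bval C1 s * bval B1 s by rewrite ler_pM2r.
      lra.
    case: alt => [oo|[v1 U0 X0 X]]; first by left; exact: join_oo oo.
    case: alt' => [oo|[v1' U0' X0' X']].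
      left=> K; have [a [a0 ha]] := join_oo C B wC wB1 uC uB oo K.
      by exists a; split => // s /ha; rewrite !bE; lra.
    have X1 := doubling_gap_Join uBk uCk v1 v1' U0 U0' X0 X0'.
    right; split; [by rewrite addr_gt0 ?mulr_gt0|by rewrite mulr_gt0|exact: ltW|by right].
Qed.

End AngleDoubling.

(** * A second eigenfrequency at or below [2 * k] *)

Section SecondZero.
Variable R : realType.
Implicit Types (A B C : branch R) (k l s t x y : R).

Lemma secular_neg A C c b : (forall s, c <= s < b -> secular A C s != 0) ->
  secular A C c < 0 -> forall s, c <= s < b -> secular A C s < 0.
Proof.
move=> nz Dc s /andP[cs sb]; rewrite -(nmulr_rgt0 _ Dc).
apply: nonzero_same_sign => //; first exact: secular_continuous.
by move=> x /andP[cx xs]; apply: nz; rewrite cx (le_lt_trans xs).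
Qed.

(** Were the value positive at [r], the last zero before [r] would have a nonnegative slope by
    [bder_zero_right]. *)
Lemma no_pos_after_zero B c r : wf B -> c <= r -> bval B c = 0 ->
  (forall z, c <= z <= r -> bval B z = 0 -> bder B z < 0) -> bval B r <= 0.
Proof.
move=> wB cr uc neg; rewrite leNgt; apply/negP => ur.
have [z [/andP[cz zr] uz nz]] := last_zero (@bval_continuous _ B) uc cr.
have zr' : z < r by rewrite lt_neqAle zr andbT; apply: contraTneq ur => <-; rewrite uz ltxx.
have := bder_zero_right wB zr' uz nz.
by rewrite pmulr_rge0 // leNgt neg // cz.
Qed.

(** Without a secular zero the secular function is negative from [c] to [b]. At zeros of [A] before
    [d] it is [bder A * bval C], so [A] crosses zero only downwards and stays nonpositive; at [d] it
    is [bval A * bder C], which calls for a positive [bval A d]. *)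
Lemma ordered_zeros_secular A C k c d b : wf A -> wf C -> 0 < k ->
  k < c -> c < d -> d < b -> bval A c = 0 -> bval C d = 0 ->
  (forall s, 0 < s < c -> 0 < bval A s) ->
  (forall s, 0 < s < d -> 0 < bval C s) ->
  exists2 s, k < s < b & secular A C s = 0.
Proof.
move=> wA wC k0 kc cd db uA uC pA pC; apply/not_exists2P => H.
have nz s : k < s < b -> secular A C s != 0.
  by move=> sb; apply/eqP => D; case: (H s).
have c0 : 0 < c by exact: lt_trans kc.
have vA := bder_first_zero wA c0 uA pA.
have vC := bder_first_zero wC (lt_trans c0 cd) uC pC.
have uCc : 0 < bval C c by rewrite pC // c0.
have Dc : secular A C c < 0.
  rewrite lt_neqAle nz ?kc ?(lt_trans cd) //= /secular uA mul0r add0r.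
  by rewrite mulr_le0_ge0 // ltW.
have Dneg : forall s, c <= s < b -> secular A C s < 0.
  apply: secular_neg => // s /andP[cs sb]; apply: nz; rewrite sb andbT.
  exact: lt_le_trans cs.
have : 0 < bval A d.
  have := Dneg d; rewrite db (ltW cd) /secular uC mulr0 addr0 => /(_ isT).
  move: vC; rewrite le_eqVlt => /predU1P[->|vC]; first by rewrite mulr0 ltxx.
  by rewrite nmulr_llt0.
apply/negP; rewrite -leNgt; apply: (@no_pos_after_zero A c) => //; first exact: ltW.
move=> z /andP[cz]; rewrite le_eqVlt => /predU1P[->|zd] uz.
  have := Dneg d; rewrite db (ltW cd) /secular uC uz mulr0 mul0r addr0 ltxx.
  by move=> /(_ isT).
have := Dneg z; rewrite cz (lt_trans zd) // /secular uz mul0r add0r => /(_ isT).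
by rewrite pmulr_llt0 // pC // zd (lt_le_trans c0).
Qed.

(** Here [A] reaches angle [pi] only at [b]. Past [c] the value of [C] becomes and stays negative.
    Divided by the negative product of values, the secular function is a sum of cotangents; that of
    [C] is bounded above and that of [A] tends to minus infinity, so the sign of the secular
    function has to change before [b]. *)
Lemma late_zero_secular A C k c b : wf A -> wf C -> 0 < k ->
  k < c < b -> bval C c = 0 ->
  (forall s, 0 < s < b -> 0 < bval A s) -> ratio_to_Noo A b ->
  (forall s, 0 < s < c -> 0 < bval C s) ->
  exists2 s, k < s < b & secular A C s = 0.
Proof.
move=> wA wC k0 /andP[kc cb] uC pA oo pC; apply/not_exists2P => H.
have nz s : k < s < b -> secular A C s != 0.
  by move=> sb; apply/eqP => D; case: (H s).
have c0 : 0 < c by exact: lt_trans kc.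
have vC := bder_first_zero wC c0 uC pC.
have Dc : secular A C c < 0.
  rewrite lt_neqAle nz ?kc //= /secular uC mulr0 addr0.
  by rewrite mulr_ge0_le0 // ltW // pA // c0.
have Dneg : forall s, c <= s < b -> secular A C s < 0.
  apply: secular_neg => // s /andP[cs sb]; apply: nz; rewrite sb andbT.
  exact: lt_le_trans cs.
have neg z : c <= z < b -> bval C z = 0 -> bder C z < 0.
  move=> zb uz; have := Dneg z zb; rewrite /secular uz mulr0 addr0 pmulr_rlt0 // pA //.
  by move/andP: zb => [cz ->]; rewrite (lt_le_trans c0).
have npos r : c <= r < b -> bval C r <= 0.
  move=> /andP[cr rb]; apply: (@no_pos_after_zero C c) => // z /andP[cz zr].
  by apply: neg; rewrite cz (le_lt_trans zr).
(* [C] cannot vanish identically after [c]: its slope is negative at its zeros, so the state is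
   nondegenerate there and the strict Wronskian inequality forbids a vanishing derivative in [s]. *)
have [r /andP[cr rb] ur] : exists2 r, c < r < b & bval C r < 0.
  apply/not_exists2P => H0; pose m := (c + b) / 2.
  have cm : c < m < b by rewrite /m; apply/andP; split; lra.
  have u0 s : c < s < b -> bval C s = 0.
    move=> /andP[cs sb]; apply/eqP; rewrite eq_le npos ?(ltW cs) //= leNgt.
    by apply/negP => us; case: (H0 s) => [|/(_ us)//]; rewrite cs sb => /(_ isT).
  have [du [dv [hu hv _ w]]] := branch_derive m wC.
  have h0 : is_derive m 1 (bval C) 0.
    apply: (@derive1_at_max R _ c b); first exact: ltW.
    + by move=> x _; have [d1 [d2 [h _ _ _]]] := branch_derive x wC.
    + by rewrite in_itv.
    + by move=> x; rewrite in_itv /= => xb; rewrite !u0.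
  have E : du = 0 by case: hu => _ <-; case: h0.
  have vm : bder C m < 0 by rewrite neg ?u0 //; case/andP: cm => /ltW->.
  move: w; rewrite (u0 m) // E mul0r mulr0 subr0 ltxx expr0n /= add0r.
  by rewrite expf_neq0 ?lt_eqF // => /(_ isT).
have nzC z : r <= z < b -> bval C z != 0.
  move=> /andP[rz zb]; apply/eqP => uz.
  have [y [/andP[ry yz] uy ny]] := first_zero (@bval_continuous _ C) uz rz.
  have ry' : r < y by rewrite lt_neqAle ry andbT; apply: contraTneq ur => ->; rewrite uy ltxx.
  have := bder_zero_left wC ry' uy ny; rewrite nmulr_rle0 // leNgt neg //.
  by rewrite (le_trans (ltW cr)) //= (le_lt_trans yz).
have [a [/andP[a0 ab] ha]] := oo (- (bder C r / bval C r)).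
pose s := Num.max a r; have sb : s < b by rewrite gt_max ab.
have rs : r <= s by rewrite le_max lexx orbT.
have as_ : a <= s by rewrite le_max lexx.
have us : bval C s < 0.
  by rewrite lt_neqAle nzC ?rs //= npos // sb (le_trans (ltW cr)).
have q : bder C s / bval C s <= bder C r / bval C r.
  apply: ratio_nincr => // z /andP[rz zs]; apply: nzC; rewrite rz.
  exact: le_lt_trans sb.
have := Dneg s; rewrite sb (le_trans (ltW cr)) // => /(_ isT); rewrite /secular.
have := ha s; rewrite as_ sb => /(_ isT) h1.
rewrite ler_ndivrMr // in q.
have uA : 0 < bval A s by rewrite pA // sb (lt_le_trans a0).
move: (_ / _) h1 q => K h1 q; apply/negP; rewrite -leNgt.
have h2 : bval A s * (K * bval C s) <= bval A s * bder C s by rewrite ler_pM2l.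
have h3 : - K * bval A s * bval C s <= bder A s * bval C s by rewrite ler_nM2r.
lra.
Qed.

(** The cases ask which sides have a Dirichlet zero below [2 * k]. A side without one is flat and
    has a cotangent tending to minus infinity at [2 * k], so a zero on the other side alone still
    suffices. *)
Lemma balanced_secular A C k : 0 < k -> wf A -> wf C -> pos k A -> pos k C ->
  bder A k = 0 -> bder C k = 0 ->
  (exists2 s, k < s < 2 * k & secular A C s = 0) \/ (flat k A /\ flat k C).
Proof.
move=> k0 wA wC pA pC vA vC.
have first B : wf B -> pos k B -> zero_below B (2 * k) -> exists c,
   [/\ k < c < 2 * k, bval B c = 0 & forall s, 0 < s < c -> 0 < bval B s].
  move=> wB pB [z /andP[z0 zk] uz].
  have [c [/andP[c0 cz] uc uB]] := first_zero_pos (@bval_continuous _ B) (bval_near0 wB) z0 uz.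
  exists c; split=> //; rewrite (le_lt_trans cz) // andbT ltNge; apply/negP => ck.
  by have := @pos_bval _ _ _ pB c; rewrite c0 ck uc ltxx => /(_ isT).
have nozero B : bder B k = 0 -> doubled k B -> flat k B /\ ratio_to_Noo B (2 * k).
  by move=> vB [_ /(_ vB) fB [//|[]]]; rewrite vB ltxx.
have [zA|nzA] := pselect (zero_below A (2 * k));
have [zC|nzC] := pselect (zero_below C (2 * k)).
- left; have [c [/andP[kc cb] uc pc]] := first _ wA pA zA.
  have [d [/andP[kd db] ud pd]] := first _ wC pC zC.
  have [cd|cd|cd] := ltrgtP c d.
  + exact: (@ordered_zeros_secular A C k c d).
  + have [s sb D] := @ordered_zeros_secular C A k d c (2 * k) wC wA k0 kd cd cb ud uc pd pc.
    by exists s => //; rewrite secularC.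
  + by exists c; rewrite ?kc // /secular uc cd ud mul0r mulr0 addr0.
- left; have [//|/(nozero _ vC) [_ oo]] := doubling_alternative k0 wC pC.
  have [c [cb uc pc]] := first _ wA pA zA.
  have pC' := no_zero_pos wC nzC.
  have [s sb D] := @late_zero_secular C A k c (2 * k) wC wA k0 cb uc pC' oo pc.
  by exists s => //; rewrite secularC.
- left; have [//|/(nozero _ vA) [_ oo]] := doubling_alternative k0 wA pA.
  have [c [cb uc pc]] := first _ wC pC zC.
  exact: (@late_zero_secular A C k c (2 * k) wA wC k0 cb uc (no_zero_pos wA nzA) oo pc).
- right; have [//|/(nozero _ vA) [fA _]] := doubling_alternative k0 wA pA.
  by have [//|/(nozero _ vC) [fC _]] := doubling_alternative k0 wC pC.
Qed.

Lemma secular0_bder_gt0 A C k : 0 < bval A k -> 0 < bval C k ->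
  secular A C k = 0 -> bder A k < 0 -> 0 < bder C k.
Proof.
move=> uA uC D vA; rewrite -(pmulr_rgt0 _ uA); move: D; rewrite /secular.
have : bder A k * bval C k < 0 by rewrite pmulr_llt0.
lra.
Qed.

Lemma secular_Ext_split l y A C s :
  secular (Ext (l - y) A) (Ext y C) s = secular (Ext l A) C s.
Proof.
rewrite -secular_Ext /secular; have [-> ->] := Ext_Ext y (l - y) A s.
by rewrite subrK.
Qed.

Lemma secular_Edge_split l y C s :
  secular (Edge (l - y)) (Ext y C) s = secular (Edge l) C s.
Proof.
rewrite -secular_Ext /secular !bE -sinD -mulrDr subrK.
have -> : cos (s * (l - y)) * cos (s * y) - sin (s * (l - y)) * sin (s * y) =
  cos (s * l) by rewrite -cosD -mulrDr subrK.
by [].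
Qed.

Lemma secular_pos2 A C k : 0 < k -> wf A -> wf C ->
  (forall s, 0 < s < k -> 0 < secular A C s) ->
  [/\ pos k A, pos k C, 0 < bval A k & 0 < bval C k].
Proof.
move=> k0 wA wC D; have kk : 0 < k <= k by rewrite k0 lexx.
have pA := secular_pos k0 wA wC D.
have pC : pos k C by apply: (@secular_pos _ _ A) => // s /D; rewrite secularC.
by split => //; [exact: (pos_bval pA)|exact: (pos_bval pC)].
Qed.

Lemma cut_secular A C k : 0 < k -> wf A -> wf C ->
  (forall s, 0 < s < k -> 0 < secular A C s) -> secular A C k = 0 ->
  bder C k = 0 ->
  (exists2 s, k < s < 2 * k & secular A C s = 0) \/ (flat k A /\ flat k C).
Proof.
move=> k0 wA wC D Dk vC; have [pA pC uA uC] := secular_pos2 k0 wA wC D.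
apply: balanced_secular => //; move/eqP: Dk.
by rewrite /secular vC mulr0 add0r mulf_eq0 (gt_eqF uC) orbF => /eqP.
Qed.

(* Moving the cut towards the side on which the ground state increases, one
   reaches a stationary point of the ground state. *)
Lemma descent_secular A C k : 0 < k -> wf A -> wf C ->
  (forall s, 0 < s < k -> 0 < secular A C s) -> secular A C k = 0 ->
  0 < bder C k -> is_join A || ~~ is_chain C ->
  exists2 s, k < s < 2 * k & secular A C s = 0.
Proof.
move=> k0; elim: A C => [l|l A IH|A IHA B IHB] C wA wC D Dk vC /= nC.
- have [pA pC uA uC] := secular_pos2 k0 wA wC D.
  have vl : bder (Ext l C) k < 0.
    move: Dk uA; rewrite /secular !bE => Dk uA.
    have c0 : cos (k * l) < 0.
      by rewrite -(pmulr_llt0 _ uC); have := mulr_gt0 uA vC; lra.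
    have h1 : bder C k * cos (k * l) < 0 by rewrite pmulr_rlt0.
    have h2 : 0 < bval C k * sin (k * l) by exact: mulr_gt0.
    lra.
  (* The stationary point lies on the leaf edge, at distance [y] from the root of [C], and not at
     the leaf itself, where the slope is strictly negative. *)
  have [y /andP[y0]] := rotate_to_zero wA vC (ltW vl).
  rewrite le_eqVlt => /predU1P[->|yl] vy; first by rewrite vy ltxx in vl.
  have wy : wf (Ext y C) by [].
  have [|s /D|||[s sk Ds]|[_ [cC _]]] := @cut_secular (Edge (l - y)) (Ext y C) k k0 _ wy.
  + by rewrite /= subr_gt0.
  + by rewrite secular_Edge_split.
  + by rewrite secular_Edge_split.
  + exact: vy.
  + by exists s => //; rewrite -(secular_Edge_split _ y).
  + by case/negP: nC.
- have [l0 wA'] := wA; have wl : wf (Ext l C) by [].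
  have D' s : 0 < s < k -> 0 < secular A (Ext l C) s by rewrite -secular_Ext; exact: D.
  have Dk' : secular A (Ext l C) k = 0 by rewrite -secular_Ext.
  have [pA pC uA uC] := secular_pos2 k0 wA' wl D'.
  have [vA|vA] := ltP (bder A k) 0.
    have [||s sk Ds] := IH (Ext l C) wA' wl D' Dk'.
    + exact: secular0_bder_gt0 Dk' vA.
    + by rewrite /= nC orbT.
    + by exists s => //; rewrite secular_Ext.
  have vl : bder (Ext l C) k <= 0.
    rewrite -(pmulr_rle0 _ uA); move: Dk'; rewrite /secular.
    have : 0 <= bder A k * bval (Ext l C) k by rewrite mulr_ge0 // ltW.
    lra.
  have [y /andP[y0]] := rotate_to_zero l0 vC vl.
  rewrite le_eqVlt => /predU1P[->|yl] vy.
    have [[s sk Ds]|[_ [cC _]]] := cut_secular k0 wA' wl D' Dk' vy.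
      by exists s => //; rewrite secular_Ext.
    by case/negP: nC.
  have wy : wf (Ext y C) by [].
  have [|s /D|||[s sk Ds]|[_ [cC _]]] := @cut_secular (Ext (l - y) A) (Ext y C) k k0 _ wy.
  + by rewrite /= subr_gt0.
  + by rewrite secular_Ext_split.
  + by rewrite secular_Ext_split.
  + exact: vy.
  + by exists s => //; rewrite -(secular_Ext_split _ y).
  + by case/negP: nC.
- have [wA1 wB] := wA; have [[pA pB] pC uAB uC] := secular_pos2 k0 wA wC D.
  have kk : 0 < k <= k by rewrite k0 lexx.
  have uA := pos_bval pA kk; have uB := pos_bval pB kk.
  have [vA|vA] := ltP (bder A k) 0.
    have Dk' : secular A (Join B C) k = 0 by rewrite -secular_Join.
    have [||||s sk Ds] := IHA (Join B C) wA1 _ _ Dk' => //.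
    + by move=> s /D; rewrite secular_Join.
    + by apply: secular0_bder_gt0 Dk' vA => //; rewrite bE mulr_gt0.
    + by rewrite orbT.
    + by exists s => //; rewrite secular_Join.
  have [vB|vB] := ltP (bder B k) 0.
    have Dk' : secular B (Join A C) k = 0 by rewrite -secular_JoinC.
    have [||||s sk Ds] := IHB (Join A C) wB _ _ Dk' => //.
    + by move=> s /D; rewrite secular_JoinC.
    + by apply: secular0_bder_gt0 Dk' vB => //; rewrite bE mulr_gt0.
    + by rewrite orbT.
    + by exists s => //; rewrite secular_JoinC.
  (* Two nonnegative slopes and a positive one cannot satisfy the Kirchhoff condition. *)
  move: Dk; rewrite /secular !bE => Dk; exfalso.
  have h1 : 0 < bval A k * bval B k * bder C k by rewrite !mulr_gt0.
  have h2 : 0 <= (bder A k * bval B k + bder B k * bval A k) * bval C k.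
    by rewrite mulr_ge0 ?addr_ge0 ?mulr_ge0 // ltW.
  lra.
Qed.

Lemma secular_Edge l B s : secular B (Edge l) s = bval (Ext l B) s.
Proof. by []. Qed.

(** The stationary point lies inside [B], in the interior of the root edge, or at its inner end.
    Only the last leaves room for equality, since in the other cases flatness would require an
    unbranched side. *)
Lemma second_zero l B k : 0 < k -> wf (Ext l B) -> is_join B ->
  bval (Ext l B) k = 0 -> (forall s, 0 < s < k -> bval (Ext l B) s != 0) ->
  (exists2 s, k < s < 2 * k & bval (Ext l B) s = 0) \/
  [/\ k * l = pi / 2, pos k B & flat k B].
Proof.
move=> k0 wE jB uk nz; have [l0 wB] := wE.
have D s : 0 < s < k -> 0 < secular B (Edge l) s.
  rewrite secular_Edge; apply: pos_before_zero => //; first exact: bval_continuous.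
  exact: bval_near0.
have [pB pE uB ul] := @secular_pos2 B (Edge l) k k0 wB l0 D.
have [vB|vB] := ltP (bder B k) 0.
  left; apply: (@descent_secular B (Edge l)) => //; last by rewrite jB.
  exact: (@secular0_bder_gt0 B (Edge l) k uB ul uk vB).
have cl : cos (k * l) <= 0.
  rewrite -(pmulr_rle0 _ uB); move: uk; rewrite !bE.
  have : 0 <= bder B k * sin (k * l) by rewrite mulr_ge0 // ltW.
  lra.
(* On the root edge the ground state is a sine, stationary a quarter wavelength away from the
   leaf. *)
pose y := pi / 2 / k; have y0 : 0 < y by rewrite !divr_gt0 ?pi_gt0.
have vy : bder (Edge y) k = 0.
  by rewrite bE mulrC /y divfK ?gt_eqF // cos_pihalf.
have : y <= l.
  rewrite leNgt; apply/negP => ly; move: cl; apply/negP; rewrite -ltNge.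
  apply: cos_gt0_pihalf; move: ly; rewrite /y ltr_pdivlMr // mulrC => ->.
  by rewrite andbT (lt_trans _ (mulr_gt0 k0 l0)) // oppr_lt0 divr_gt0 ?pi_gt0.
rewrite le_eqVlt => /predU1P[yl|yl].
  rewrite yl in vy; have [z|[fB _]] := @cut_secular B (Edge l) k k0 wB l0 D uk vy.
    by left.
  by right; split => //; rewrite -yl /y mulrC divfK // gt_eqF.
left; have split s : secular (Ext (l - y) B) (Edge y) s = bval (Ext l B) s.
  by rewrite secular_Edge; have [-> _] := Ext_Ext y (l - y) B s; rewrite subrK.
have [|s /D|||[s sk Ds]|[[cB _] _]] := @cut_secular (Ext (l - y) B) (Edge y) k k0 _ y0.
- by rewrite /= subr_gt0.
- by rewrite split.
- by rewrite split.
- exact: vy.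
- by exists s; rewrite -?split.
- by move: jB cB; case: (B).
Qed.

End SecondZero.

(** * The eigenvalue equation on one edge *)

Section EdgeODE.
Variable R : realType.
Notation mu := (@lebesgue_measure R).
Implicit Types (f g h : R -> R) (l x y : R).

(** On a bounded interval [|g| <= 1 + g ^ 2] is integrable. *)
Lemma H1_integrable l f g : H1_deriv l f g -> mu.-integrable `[0, l] (EFin \o g).
Proof.
move=> [mg ig _].
have i1 : mu.-integrable `[0, l] (EFin \o cst (1 : R)).
  apply: continuous_compact_integrable; first exact: segment_compact.
  by apply: continuous_subspaceT; exact: cst_continuous.
have := @integrableD _ _ _ mu `[0, l] (measurable_itv _) _ _ i1 ig.
apply: le_integrable; first exact: measurable_itv.
  exact/measurable_EFinP.
move=> x _ /=; rewrite lee_fin [leRHS]ger0_norm ?addr_ge0 ?sqr_ge0 //.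
rewrite -(real_normK (num_real (g x))); have := sqr_ge0 (`|g x| - 1).
by have := normr_ge0 (g x); nra.
Qed.

Lemma H1_continuous l f g : 0 < l -> H1_deriv l f g -> {within `[0, l], continuous f}.
Proof.
move=> l0 H; have ig := H1_integrable H; case: H => _ _ fE.
pose F := fun x => f 0 + parameterized_integral mu 0 x g.
apply: (@subspace_eq_continuous _ _ _ F).
  by move=> x; rewrite inE/= in_itv /= => xl; rewrite /F /parameterized_integral -fE.
move=> x; apply: cvgD; first exact: cvg_cst.
exact: (parameterized_integral_continuous (ltW l0) ig).
Qed.

(** A weak derivative that agrees almost everywhere with a continuous function is a classical one;
    this is how eigenfunctions obtain classical second derivatives. *)
Lemma H1_is_derive l f g h : 0 < l -> H1_deriv l f g ->
  {within `[0, l], continuous h} ->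
  {ae mu, forall x, x \in `[0, l] -> g x = h x} ->
  forall x, 0 < x < l -> is_derive x 1 f (h x).
Proof.
move=> l0 H ch gh x x0l; have ig := H1_integrable H; case: H => mg _ fE.
have ih : mu.-integrable `[0, l] (EFin \o h).
  by apply: continuous_compact_integrable => //; exact: segment_compact.
have /andP[x0 xl] := x0l.
have chx : {for x, continuous h}.
  have /(continuous_within_itvP _ l0)[+ _ _] := ch; apply.
  by rewrite in_itv /= x0.
have [dF F'] := continuous_FTC1_closed xl ih x0 chx.
have hF : is_derive x 1 (fun y => \int[mu]_(t in `[0, y]) h t) (h x).
  by apply: DeriveDef; [exact: dF|rewrite -derive1E; exact: F'].
have hF2 : is_derive x 1 (fun y => f 0 + \int[mu]_(t in `[0, y]) h t) (h x).
  have := is_deriveD (is_derive_cst (f 0) x 1) hF.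
  by rewrite add0r.
apply: near_eq_is_derive hF2.
near=> y.
have yl : 0 <= y <= l.
  by apply/andP; split; apply: ltW; near: y; [exact: lt_nbhsr|exact: lt_nbhsl].
rewrite (fE y yl); congr (_ + _).
rewrite /Rintegral; congr fine; apply: ae_eq_integral.
- exact: measurable_itv.
- apply/measurable_EFinP; case/integrableP: ih => /measurable_EFinP + _.
  by apply: measurable_funS => //; apply: subset_itvl; rewrite bnd_simp; case/andP: yl.
- apply/measurable_EFinP; move: mg.
  by apply: measurable_funS => //; apply: subset_itvl; rewrite bnd_simp; case/andP: yl.
- move: gh; apply: filterS; first exact: (ae_filter_ringOfSetsType mu).
  move=> t gh; rewrite /= in_itv /= => /andP[t0 ty].
  by rewrite gh // in_itv /= t0; case/andP: yl => _; apply: le_trans.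
Unshelve. all: by end_near. Qed.

Lemma constant_on_segment l f : 0 < l -> {within `[0, l], continuous f} ->
  (forall x, 0 < x < l -> is_derive x 1 f 0) ->
  forall x, 0 <= x <= l -> f x = f 0.
Proof.
move=> l0 cf df x /andP[x0 xl].
have [y||c _] := @MVT_segment R f (cst 0) 0 x x0.
- rewrite in_itv /= => /andP[y0 yx]; apply: df; rewrite y0 /=.
  exact: lt_le_trans xl.
- apply: (@continuous_subspaceW _ _ `[0, x] `[0, l]) => //.
  by apply: subset_itvl; rewrite bnd_simp.
- by rewrite mul0r => /eqP; rewrite subr_eq0 => /eqP.
Qed.

Definition edge_ode l lam f g :=
  [/\ {within `[0, l], continuous f}, {within `[0, l], continuous g},
      forall x, 0 < x < l -> is_derive x 1 f (g x) &
      forall x, 0 < x < l -> is_derive x 1 g (- lam * f x)].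

Lemma H1_edge_ode l lam f g h : 0 < l -> H1_deriv l f g -> H1_deriv l g h ->
  {ae mu, forall x, x \in `[0, l] -> - h x = lam * f x} -> edge_ode l lam f g.
Proof.
move=> l0 H1 H2 ae.
have cf := H1_continuous l0 H1; have cg := H1_continuous l0 H2.
split=> //.
  by apply: (H1_is_derive l0 H1) => //; apply: filterE; first exact: (ae_filter_ringOfSetsType mu).
apply: (H1_is_derive l0 H2).
  by move=> x; apply: cvgM; [exact: cvg_cst|exact: cf].
move: ae; apply: filterS; first exact: (ae_filter_ringOfSetsType mu).
by move=> x h1 /h1 E; rewrite mulNr -E opprK.
Qed.

(** Rotating the pair [(f, g / s)] back by [x * s] gives the functions [a] and [b], whose
    derivatives vanish. *)
Lemma edge_ode_trig l s f g : 0 < l -> 0 < s -> edge_ode l (s ^+ 2) f g ->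
  forall x, 0 <= x <= l ->
    f x = f 0 * cos (x * s) + g 0 / s * sin (x * s) /\
    g x / s = g 0 / s * cos (x * s) - f 0 * sin (x * s).
Proof.
move=> l0 s0 [cf cg df dg] x xl.
have hs y := is_derive_sinM y s; have hc y := is_derive_cosM y s.
have csin : {within `[0, l], continuous (fun y => sin (y * s))}.
  by apply: continuous_subspaceT; exact: continuous_sinM.
have ccos : {within `[0, l], continuous (fun y => cos (y * s))}.
  by apply: continuous_subspaceT; exact: continuous_cosM.
pose a := fun y => f y * cos (y * s) - s^-1 * (g y * sin (y * s)).
pose b := fun y => f y * sin (y * s) + s^-1 * (g y * cos (y * s)).
have ca : {within `[0, l], continuous a}.
  move=> y; apply: cvgB; first by apply: cvgM; [exact: cf|exact: ccos].
  apply: cvgM; first exact: cvg_cst.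
  by apply: cvgM; [exact: cg|exact: csin].
have cb : {within `[0, l], continuous b}.
  move=> y; apply: cvgD; first by apply: cvgM; [exact: cf|exact: csin].
  apply: cvgM; first exact: cvg_cst.
  by apply: cvgM; [exact: cg|exact: ccos].
have hcst (y : R) := is_derive_cst (s^-1) y (1 : R).
have aE : f x * cos (x * s) - s^-1 * (g x * sin (x * s)) = f 0.
  have -> : f 0 = a 0 by rewrite /a mul0r cos0 sin0 !mulr0 subr0 mulr1.
  apply: (constant_on_segment l0 ca) => // y yl.
  apply: is_derive_eq; first exact: (is_deriveB (is_deriveM (df y yl) (hc y))
     (is_deriveM (hcst y) (is_deriveM (dg y yl) (hs y)))).
  by rewrite /GRing.scale /=; field; rewrite gt_eqF.
have bE : f x * sin (x * s) + s^-1 * (g x * cos (x * s)) = g 0 / s.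
  have -> : g 0 / s = b 0 by rewrite /b mul0r cos0 sin0 mulr0 add0r mulr1 mulrC.
  apply: (constant_on_segment l0 cb) => // y yl.
  apply: is_derive_eq; first exact: (is_deriveD (is_deriveM (df y yl) (hs y))
     (is_deriveM (hcst y) (is_deriveM (dg y yl) (hc y)))).
  by rewrite /GRing.scale /=; field; rewrite gt_eqF.
rewrite -aE -bE; split.
  by rewrite -[LHS]mulr1 -(cos2Dsin2 (x * s)); ring.
by rewrite -[LHS]mulr1 -(cos2Dsin2 (x * s)); ring.
Qed.

(* For [lam <= 0] the product [f * f'] is nondecreasing along the edge *)
Lemma edge_ode_nonpos l lam f g : 0 < l -> lam <= 0 -> edge_ode l lam f g ->
  f 0 * g 0 <= f l * g l /\
  (f 0 * g 0 = f l * g l -> forall x, 0 <= x <= l -> f x = f 0).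
Proof.
move=> l0 lam0 [cf cg df dg]; pose p := fun y => f y * g y.
have cp : {within `[0, l], continuous p}.
  by move=> y; apply: cvgM; [exact: cf|exact: cg].
have dp y : 0 < y < l -> is_derive y 1 p (g y ^+ 2 - lam * f y ^+ 2).
  move=> yl; apply: is_derive_eq; first exact: (is_deriveM (df y yl) (dg y yl)).
  by rewrite /GRing.scale /=; ring.
have p0 y : 0 <= g y ^+ 2 - lam * f y ^+ 2.
  by rewrite subr_ge0 (le_trans _ (sqr_ge0 _)) // mulr_le0_ge0 // sqr_ge0.
have mono : {in `[0, l] &, {homo p : x y / x <= y}}.
  apply: ger0_derive1_le_cc => //.
    by move=> y; rewrite in_itv /= => /dp [].
  by move=> y; rewrite in_itv /= => /dp [_ h]; rewrite derive1E h.
have in0 : 0 \in `[0, l] by rewrite in_itv /= lexx ltW.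
have inl : l \in `[0, l] by rewrite in_itv /= lexx ltW.
split; first by apply: (mono 0 l) => //; exact: ltW.
move=> E; apply: (constant_on_segment l0 cf) => x xl.
have pc y : 0 < y < l -> p y = p 0.
  move=> /andP[y0 yl]; have iy : y \in `[0, l] by rewrite in_itv /= !ltW.
  apply/eqP; rewrite eq_le; apply/andP; split; last by apply: mono => //; exact: ltW.
  by rewrite {2}/p E; apply: mono => //; exact: ltW.
have h0 : is_derive x 1 p 0.
  apply: near_eq_is_derive (is_derive_cst (p 0) x 1).
  have := @near_in_itvoo R 0 l x; rewrite in_itv /= => /(_ xl).
  by apply: filterS => y; rewrite in_itv /= => /pc.
have /eqP : g x ^+ 2 - lam * f x ^+ 2 = 0 by case: (dp x xl) => _ <-; case: h0.
rewrite -mulNr paddr_eq0 ?sqr_ge0 //; last by rewrite mulr_ge0 ?sqr_ge0 ?oppr_ge0.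
by case/andP; rewrite sqrf_eq0 => /eqP gx _; rewrite -gx; exact: df.
Qed.

Lemma smooth_H1 l f g : 0 < l -> (forall x, is_derive x 1 f (g x)) ->
  continuous g -> H1_deriv l f g.
Proof.
move=> l0 df cg; split.
- exact: measurable_funTS (continuous_measurable_fun cg).
- apply: continuous_compact_integrable; first exact: segment_compact.
  by apply: continuous_subspaceT; exact: (continuous_mul cg cg).
- have cf : continuous f.
    by move=> x; apply/differentiable_continuous/derivable1_diffP; case: (df x).
  move=> x /andP[]; rewrite le_eqVlt => /predU1P[<- _|x0 _].
    by rewrite set_itv1 Rintegral_set1 addr0.
  rewrite /Rintegral (@continuous_FTC2 R g f 0 x) //.
  + by rewrite /= subrKC.
  + exact: continuous_subspaceT.
  + split=> [y _||]; first by case: (df y).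
      exact/cvg_at_right_filter/cf.
    exact/cvg_at_left_filter/cf.
  + by move=> y _; rewrite derive1E; case: (df y).
Qed.

Lemma trig_H1 l s a b : 0 < l ->
  H1_deriv l (fun x => a * cos (x * s) + b * sin (x * s))
    (fun x => s * (b * cos (x * s) - a * sin (x * s))) /\
  H1_deriv l (fun x => s * (b * cos (x * s) - a * sin (x * s)))
    (fun x => - (s ^+ 2) * (a * cos (x * s) + b * sin (x * s))).
Proof.
move=> l0; have cc := @continuous_cosM R s; have cs := @continuous_sinM R s.
have ck (k : R) (f : R -> R) : continuous f -> continuous (fun x => k * f x).
  by move=> cf; apply: continuous_mul => //; exact: cst_continuous.
have hs y := is_derive_sinM y s; have hc y := is_derive_cosM y s.
have hcst (k y : R) := is_derive_cst k y (1 : R).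
split; apply: smooth_H1 => //.
- move=> x; have h := is_deriveD (is_deriveM (hcst a x) (hc x))
    (is_deriveM (hcst b x) (hs x)).
  refine (is_derive_eq h _).
  by rewrite /GRing.scale /=; ring.
- by apply: (ck); apply: continuous_sub; exact: (ck).
- move=> x; have h := is_deriveM (hcst s x) (is_deriveB
    (is_deriveM (hcst b x) (hc x)) (is_deriveM (hcst a x) (hs x))).
  refine (is_derive_eq h _).
  by rewrite /GRing.scale /=; ring.
- by apply: (ck); apply: continuous_add; exact: (ck).
Qed.

End EdgeODE.

(** * Rooted trees *)

(* [pe x] is the edge from [x] to its parent [par x]; both are junk at the root. *)
Record rooting (R : realType) (G : metric_graph R) (r : vertex G) := Rooting {
  depth : vertex G -> nat;
  par : vertex G -> vertex G;
  pe : vertex G -> edge G;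
  depth_root : depth r = 0%N;
  depth_par : forall x, x != r -> depth x = (depth (par x)).+1;
  pe_joins : forall x, x != r -> joins (pe x) x (par x);
  pe_inj : forall x y, x != r -> y != r -> pe x = pe y -> x = y;
  pe_surj : forall e, exists2 x, x != r & pe x = e }.

Section Rooting.
Variables (R : realType) (G : metric_graph R).
Implicit Types (x y z v w r : vertex G) (e : edge G).

Lemma joinsC e x y : joins e x y -> joins e y x.
Proof. by case; [right|left]. Qed.

(** Depth is the distance to [r], and the parent edge is the last edge of a shortest path. Parent
    edges of distinct vertices differ, and by the Betti number there are as many edges as vertices
    other than [r], so every edge is a parent edge. *)
Lemma tree_rooting (e0 : edge G) r : is_tree G -> inhabited (rooting r).
Proof.
move=> [conn b1]; pose adj := @Defs.adjacent R G.
pose P x n := `[< exists p, [/\ path adj r p, last r p = x & size p = n] >].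
have exP x : exists n, P x n.
  by have /connectP[p pp xE] := conn r x; exists (size p); apply/asboolP; exists p.
pose d x := ex_minn (exP x).
have dP x : exists p, [/\ path adj r p, last r p = x & size p = d x].
  by rewrite /d; case: ex_minnP => n /asboolP.
have dmin x p : path adj r p -> last r p = x -> (d x <= size p)%N.
  by move=> pp lp; rewrite /d; case: ex_minnP => n _; apply; apply/asboolP; exists p.
have dr : d r = 0%N by apply/eqP; rewrite -leqn0; exact: (dmin r [::]).
have H x : exists ye : vertex G * edge G, x != r ->
    d x = (d ye.1).+1 /\ joins ye.2 x ye.1.
  have [p [pp lp sp]] := dP x.
  case/lastP: p pp lp sp => [_ <- _|p y].
    by exists (r, e0); rewrite eqxx.
  rewrite rcons_path last_rcons size_rcons => /andP[pp py] yx sp.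
  subst y; have /existsP[e he] := py; exists (last r p, e) => _ /=; split.
    apply/eqP; rewrite eqn_leq -{2}sp ltnS dmin // andbT.
    have [q [pq lq <-]] := dP (last r p).
    have := dmin x (rcons q x); rewrite rcons_path last_rcons size_rcons pq lq.
    by apply.
  by case/orP: he => /andP[/eqP <- /eqP <-]; [right|left].
have [ye hye] := choice H; pose pr x := (ye x).1; pose pd x := (ye x).2.
have dpar x : x != r -> d x = (d (pr x)).+1 by move=> /hye[].
have pj x : x != r -> joins (pd x) x (pr x) by move=> /hye[].
have pinj x y : x != r -> y != r -> pd x = pd y -> x = y.
  move=> xr yr E; have := pj x xr; have := pj y yr; rewrite -E.
  (* Distinct vertices with the same parent edge would be parents of each other, against the
     depths. *)
  have swap : x = pr y -> pr x = y -> x = y.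
    move=> xy yx; have := dpar x xr; rewrite yx (dpar y yr) -xy => /eqP.
    by rewrite -addn2 -[X in X == _]addn0 eqn_add2l.
  move=> [] [s1 t1] [] [s2 t2]; [by rewrite -s1 s2| | |by rewrite -t1 t2];
    by apply: swap; congruence.
have cardE : #|edge G|.+1 = #|vertex G|.
  by move: b1; rewrite /betti1; lia.
have psurj e : exists2 x, x != r & pd x = e.
  have inj : {in [set~ r]%SET &, injective pd}.
    by move=> x y; rewrite !inE => xr yr; exact: pinj.
  have : [set: edge G]%SET = pd @: [set~ r]%SET.
    apply/esym/eqP; rewrite eqEcard finset.subsetT /= (card_in_imset inj) cardsC1 cardsT.
    by rewrite -cardE.
  by move/setP/(_ e); rewrite inE => /esym/imsetP[x]; rewrite !inE => xr ->; exists x.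
by split; exact: (Rooting dr dpar pj pinj psurj).
Qed.

End Rooting.

Section RootedTree.
Variables (R : realType) (G : metric_graph R) (r : vertex G) (T : rooting r).
Implicit Types (x y z v w : vertex G) (e : edge G).

Local Notation depth := (depth T).
Local Notation par := (par T).
Local Notation pe := (pe T).

Lemma depth_gt0 x : x != r -> (0 < depth x)%N.
Proof. by move=> /(depth_par T) ->. Qed.

Lemma par_neq x : x != r -> par x != x.
Proof.
move=> xr; apply/eqP => E; have := depth_par T xr; rewrite E => /eqP.
by rewrite ltn_eqF.
Qed.

Definition pv e : vertex G := s2val (cid2 (pe_surj T e)).
Lemma pv_neq e : pv e != r. Proof. exact: (s2valP (cid2 (pe_surj T e))). Qed.
Lemma pvK e : pe (pv e) = e. Proof. exact: (s2valP' (cid2 (pe_surj T e))). Qed.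
Lemma peK x : x != r -> pv (pe x) = x.
Proof. by move=> xr; apply: (@pe_inj _ _ _ T) => //; [exact: pv_neq|rewrite pvK]. Qed.

Lemma sum_edges (M : nmodType) (F : edge G -> M) :
  \sum_e F e = \sum_(y | y != r) F (pe y).
Proof.
rewrite (reindex_onto pe pv) /=; last by move=> e _; exact: pvK.
apply: eq_bigl => y; have [->|yr] := eqVneq y r; last by rewrite peK // eqxx.
by apply/negbTE; exact: pv_neq.
Qed.

Definition fwd y := src (pe y) == y.

Lemma pe_ends y : y != r ->
  if fwd y then src (pe y) = y /\ tgt (pe y) = par y
  else src (pe y) = par y /\ tgt (pe y) = y.
Proof.
move=> yr; rewrite /fwd; case: (pe_joins T yr) => -[-> ->]; first by rewrite eqxx.
by rewrite (negbTE (par_neq yr)).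
Qed.

Definition ch x := [seq y <- enum (vertex G) | (y != r) && (par y == x)].

Lemma mem_ch x y : (y \in ch x) = (y != r) && (par y == x).
Proof. by rewrite mem_filter mem_enum andbT. Qed.

Lemma ch_uniq x : uniq (ch x).
Proof. by rewrite filter_uniq // enum_uniq. Qed.

Lemma sum_ch (M : nmodType) (F : vertex G -> M) x :
  \sum_(y <- ch x) F y = \sum_(y | (y != r) && (par y == x)) F y.
Proof. by rewrite big_filter big_enum_cond. Qed.

Lemma degree_rooted x : degree x = ((x != r) + size (ch x))%N.
Proof.
have card_sum (P : pred (edge G)) : #|[set e | P e]%SET| = (\sum_e P e)%N.
  by rewrite -sum1_card big_mkcond /=; apply: eq_bigr => e _; rewrite inE; case: (P e).
rewrite /degree !card_sum -big_split /= sum_edges.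
transitivity (\sum_(y | y != r) ((y == x) + (par y == x)))%N.
  apply: eq_bigr => y yr; have := pe_ends yr.
  by case: (fwd y) => -[-> ->] //; rewrite addnC.
rewrite big_split /=; congr (_ + _)%N.
  have [->|xr] := eqVneq x r.
    by rewrite big1 // => y /negbTE ->.
  rewrite (bigD1 x) //= eqxx big1 ?addn0 // => y /andP[_ /negbTE] ->.
  by [].
by rewrite -sum1_size sum_ch [RHS]big_mkcondr.
Qed.

Lemma leaf_rooted x : x != r -> leaf x = (ch x == [::]).
Proof. by move=> xr; rewrite /leaf degree_rooted xr /= -size_eq0; case: size. Qed.

Lemma leaf_root : leaf r = (size (ch r) == 1%N).
Proof. by rewrite /leaf degree_rooted eqxx. Qed.

(* Derivatives along [pe y], oriented into [y] and into [par y] respectively. *)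
Definition into (f1 : edge G -> R -> R) y : R :=
  if fwd y then - f1 (pe y) 0 else f1 (pe y) (len (pe y)).
Definition out (f1 : edge G -> R -> R) y : R :=
  if fwd y then f1 (pe y) (len (pe y)) else - f1 (pe y) 0.

Lemma flux_rooted f1 x : x != r ->
  flux f1 x = into f1 x + \sum_(y <- ch x) out f1 y.
Proof.
move=> xr; rewrite /flux [X in X - _]big_mkcond [X in _ - X]big_mkcond -sumrB sum_edges.
transitivity (\sum_(y | y != r) ((if y == x then into f1 y else 0) +
   (if par y == x then out f1 y else 0))).
  apply: eq_bigr => y yr; have := pe_ends yr; rewrite /into /out.
  case: (fwd y) => -[-> ->]; last by congr (_ + _); case: ifP; rewrite ?oppr0.
  by rewrite addrC; congr (_ + _); case: ifP; rewrite ?oppr0.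
rewrite big_split /=; congr (_ + _); last by rewrite sum_ch [RHS]big_mkcondr.
by rewrite (bigD1 x) //= eqxx big1 ?addr0 // => y /andP[_ /negbTE] ->.
Qed.

Lemma depth_iter n y : (n <= depth y)%N -> depth (iter n par y) = (depth y - n)%N.
Proof.
elim: n => [|n IH] ny /=; first by rewrite subn0.
have E := IH (ltnW ny); have nr : iter n par y != r.
  apply: contraTneq ny => nr; move: E; rewrite nr (depth_root T) => /esym/eqP.
  by rewrite subn_eq0 -ltnNge ltnS.
by have := depth_par T nr; rewrite E; lia.
Qed.

Definition maxdepth := \max_x depth x.
Lemma depth_le_max x : (depth x <= maxdepth)%N.
Proof. exact: leq_bigmax. Qed.

Lemma up_ind (P : vertex G -> Prop) :
  (forall x, x != r -> (forall y, y \in ch x -> P y) -> P x) ->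
  forall x, x != r -> P x.
Proof.
move=> IH x; have [n] := ubnP (maxdepth - depth x).
elim: n x => // n IHn x hn xr; apply: (IH) => // y; rewrite mem_ch => /andP[yr /eqP yx].
apply: IHn => //; have := depth_par T yr; rewrite yx.
have := depth_le_max y; lia.
Qed.

Lemma down_ind (P : vertex G -> Prop) : P r ->
  (forall x, x != r -> P (par x) -> P x) -> forall x, P x.
Proof.
move=> Pr IH x; have [n] := ubnP (depth x); elim: n x => // n IHn x hn.
have [->//|xr] := eqVneq x r; apply: IH => //; apply: IHn.
by have := depth_par T xr; lia.
Qed.

End RootedTree.

(** A vertex of maximal depth has no child; it is not the root, because the edge [e0] yields a
    vertex of positive depth. *)
Lemma tree_leaf (R : realType) (G : metric_graph R) (e0 : edge G) :
  is_tree G -> exists r : vertex G, leaf r.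
Proof.
move=> tG; have [T] := tree_rooting e0 (src e0) tG.
have [x _ hx] := @arg_maxnP _ (src e0) predT (depth T) isT.
have xr : x != src e0.
  have [y yr _] := pe_surj T e0; apply/eqP => xr; have : (depth T y <= depth T x)%N := hx y isT.
  by rewrite xr (depth_root T) leqNgt depth_gt0.
exists x; rewrite (leaf_rooted T) //; case E: (ch T x) => [//|y s].
have : y \in ch T x by rewrite E mem_head.
rewrite mem_ch => /andP[yr /eqP yx]; have : (depth T y <= depth T x)%N := hx y isT.
by rewrite (depth_par T yr) yx ltnn.
Qed.

(** * From branches to eigenfunctions *)

Section Lists.
Variable R : realType.
Implicit Types (B C : branch R) (p q : R * R) (l s : R).

Fixpoint joinl B (Bs : seq (branch R)) : branch R :=
  if Bs is C :: Cs then Join B (joinl C Cs) else B.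

Definition stem l (Bs : seq (branch R)) : branch R :=
  if Bs is B :: Cs then Ext l (joinl B Cs) else Edge l.

Definition pjoin p q : R * R := (p.1 * q.1, p.2 * q.1 + q.2 * p.1).

(** The start (1, 0) is neutral for [pjoin] and is the Neumann state. A childless vertex needs the
    Dirichlet state (0, 1) instead, hence the case distinctions on empty lists. *)
Definition pjoins (ps : seq (R * R)) : R * R := foldr pjoin (1, 0) ps.

Definition turn l s p : R * R :=
  (p.1 * cos (s * l) + p.2 * sin (s * l), p.2 * cos (s * l) - p.1 * sin (s * l)).

Lemma bstate_joinl B Bs s :
  bstate (joinl B Bs) s = pjoins [seq bstate C s | C <- B :: Bs].
Proof.
elim: Bs B => [|C Cs IH] B /=.
  by rewrite /pjoin /= !mulr1 mul0r addr0; case: (bstate B s).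
by rewrite (IH C).
Qed.

Lemma bstate_stem l Bs s : bstate (stem l Bs) s =
  turn l s (if Bs is [::] then (0, 1) else pjoins [seq bstate C s | C <- Bs]).
Proof.
case: Bs => [|B Bs] /=; first by rewrite /turn /= !mul0r !mul1r add0r subr0.
by rewrite (bstate_joinl B Bs).
Qed.

Lemma wf_stem l Bs : 0 < l -> (forall i, (i < size Bs)%N -> wf (nth (Edge 1) Bs i)) ->
  wf (stem l Bs).
Proof.
move=> l0; case: Bs => [//|B Bs] h; split=> //.
elim: Bs B h => [|C Cs IH] B h /=; first exact: (h 0%N).
by split; [exact: (h 0%N)|apply: IH => i iC; exact: (h i.+1)].
Qed.

Lemma turn_inj0 l s p : (turn l s p).1 = 0 -> (turn l s p).2 = 0 -> p = (0, 0).
Proof.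
rewrite /turn /=; set c := cos _; set d := sin _ => h1 h2.
have cd : c ^+ 2 + d ^+ 2 = 1 := cos2Dsin2 _.
have h : p.1 = 0 by rewrite -[LHS]mulr1 -cd; transitivity
  ((p.1 * c + p.2 * d) * c - (p.2 * c - p.1 * d) * d); [ring|rewrite h1 h2; ring].
have h' : p.2 = 0 by rewrite -[LHS]mulr1 -cd; transitivity
  ((p.1 * c + p.2 * d) * d + (p.2 * c - p.1 * d) * c); [ring|rewrite h1 h2; ring].
by case: p h h' {h1 h2} => a b /= -> ->.
Qed.

Lemma turn0 l s p : p = (0, 0) -> turn l s p = (0, 0).
Proof. by move=> ->; rewrite /turn /= !mul0r addr0 subr0. Qed.

Lemma turn_proportional l s p q : p.1 * q.2 = p.2 * q.1 ->
  (turn l s p).1 * (turn l s q).2 = (turn l s p).2 * (turn l s q).1.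
Proof.
move=> h; rewrite /turn /=; set c := cos _; set d := sin _.
apply/eqP; rewrite -subr_eq0; apply/eqP.
transitivity ((p.1 * q.2 - p.2 * q.1) * (c ^+ 2 + d ^+ 2)); first ring.
by rewrite h subrr mul0r.
Qed.

Variable I : eqType.
Implicit Types (st : I -> R * R) (zs : seq I).

Lemma pjoins_proportional st zs (a : R) (b : I -> R) :
  {in zs, forall z, a * (st z).2 = b z * (st z).1} ->
  a * (pjoins (map st zs)).2 = (\sum_(z <- zs) b z) * (pjoins (map st zs)).1.
Proof.
elim: zs => [|z zs IH] h; first by rewrite big_nil mul0r mulr0.
rewrite big_cons /= /pjoin /=.
have h1 := h z (mem_head _ _).
have := IH (fun y yz => h y (@mem_behead _ (z :: zs) y yz)).
rewrite /pjoins; move: (foldr _ _ _) => q hq.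
transitivity ((a * (st z).2) * q.1 + (a * q.2) * (st z).1); first ring.
by rewrite h1 hq; ring.
Qed.

Lemma pjoins_degenerate st zs z : z \in zs -> st z = (0, 0) ->
  pjoins (map st zs) = (0, 0).
Proof.
elim: zs => [//|y zs IH]; rewrite inE => /orP[/eqP ->|zz] h /=.
  by rewrite /pjoin h /= !mul0r mulr0 addr0.
by rewrite IH // /pjoin /= !mulr0 mul0r addr0.
Qed.

Lemma pjoins_val0 st zs z : z \in zs -> (st z).1 = 0 -> (pjoins (map st zs)).1 = 0.
Proof.
elim: zs => [//|y zs IH]; rewrite inE => /orP[/eqP ->|zz] h /=.
  by rewrite h mul0r.
by rewrite IH // mulr0.
Qed.

(** A nondegenerate joint state has at most one factor with value 0. The other [b z] vanish at once,
    and the zero sum removes the remaining one. *)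
Lemma pjoins_zero st zs (b : I -> R) : uniq zs -> pjoins (map st zs) <> (0, 0) ->
  {in zs, forall z, b z * (st z).1 = 0} -> \sum_(z <- zs) b z = 0 ->
  {in zs, forall z, b z = 0}.
Proof.
elim: zs => [//|z zs IH] /= /andP[znz un] nd h; rewrite big_cons => s0.
have hz := h z (mem_head _ _).
have nd' : pjoins (map st zs) <> (0, 0).
  by move=> E; apply: nd; rewrite E /pjoin /= !mulr0 mul0r addr0.
have hzs y : y \in zs -> b y * (st y).1 = 0 by move=> yz; apply: h; rewrite inE yz orbT.
suff bz : b z = 0.
  move=> y; rewrite inE => /orP[/eqP -> //|yz]; apply: IH => //.
  by move: s0; rewrite bz add0r.
have [u0|u0] := eqVneq (st z).1 0; last first.
  by move/eqP: hz; rewrite mulf_eq0 (negbTE u0) orbF => /eqP.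
suff : {in zs, forall y, b y = 0}.
  by move=> bzs; move: s0; rewrite big_seq big1 ?addr0 // => y /bzs.
move=> y yz; move/eqP: (hzs y yz); rewrite mulf_eq0 => /orP[/eqP //|/eqP uy].
by case: nd; rewrite /pjoin u0 (pjoins_val0 yz uy) !mulr0 addr0.
Qed.

(* Scale the solutions on the branches so that they agree at the joint vertex;
   when two or more of them vanish there, use their slopes instead. *)
Lemma pjoins_coef st zs : uniq zs -> exists al : I -> R,
  [/\ {in zs, forall z, al z * (st z).1 = (pjoins (map st zs)).1},
      \sum_(z <- zs) al z * (st z).2 = (pjoins (map st zs)).2 &
      zs != [::] -> exists2 z, z \in zs & al z != 0].
Proof.
elim: zs => [_|z zs IH /= /andP[znz un]].
  by exists (fun=> 0); split; rewrite ?big_nil.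
have [al [h1 h2 h3]] := IH un.
have nez y : y \in zs -> (y == z) = false.
  by move=> yz; apply/negbTE; apply: contraNneq znz => <-.
pose mix (a b : R) (y : I) := if y == z then a else b * al y.
have mixz a b : mix a b z = a by rewrite /mix eqxx.
have mixy a b y : y \in zs -> mix a b y = b * al y by move=> /nez; rewrite /mix => ->.
have mixsum a b : \sum_(y <- z :: zs) mix a b y * (st y).2 =
    a * (st z).2 + b * (pjoins (map st zs)).2.
  rewrite big_cons mixz -h2 mulr_sumr; congr (_ + _).
  by apply: eq_big_seq => y yz; rewrite mixy // mulrA.
have mixval a b U : a * (st z).1 = U -> b * (pjoins (map st zs)).1 = U ->
    {in z :: zs, forall y, mix a b y * (st y).1 = U}.
  move=> ha hb y; rewrite inE => /orP[/eqP ->|yz]; first by rewrite mixz.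
  by rewrite mixy // -mulrA h1.
case: zs => [|z' zs'] in znz un IH al h1 h2 h3 nez mix mixz mixy mixsum mixval *.
  exists (mix 1 (st z).1); split.
  - by apply: mixval; rewrite /= ?mulr1 ?mul1r.
  - by rewrite mixsum /= mulr0 addr0 mul1r mulr1 mul0r addr0.
  - by move=> _; exists z; rewrite ?mem_head // mixz oner_eq0.
have {h3}[z1 z1in z1n] := h3 isT.
move: h1 h2 mixsum mixval; set zs := z' :: zs' in znz un IH nez mix mixz mixy z1in *.
set q := pjoins (map st zs) => h1 h2 mixsum mixval.
have [u0|u0] := eqVneq (st z).1 0; last first.
  exists (mix q.1 (st z).1); split.
  - by apply: mixval; rewrite /pjoin //= mulrC.
  - by rewrite mixsum /pjoin /= mulrC [(st z).1 * _]mulrC.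
  - by move=> _; exists z1; rewrite ?mixy ?mulf_neq0 // inE z1in orbT.
have [q0|q0] := eqVneq q.1 0; last first.
  exists (mix q.1 (st z).1); split.
  - by apply: mixval; rewrite /pjoin //= mulrC.
  - by rewrite mixsum /pjoin /= mulrC [(st z).1 * _]mulrC.
  - by move=> _; exists z; rewrite ?mixz // mem_head.
rewrite u0 q0 !mulr0 addr0.
have [v0|v0] := eqVneq (st z).2 0.
  exists (mix 1 0); split.
  - by apply: mixval; rewrite ?u0 ?mulr0 ?mul0r.
  - by rewrite mixsum v0 mulr0 mul0r addr0.
  - by move=> _; exists z; rewrite ?mem_head // mixz oner_eq0.
(* Both values vanish, so the joint state is (0, 0); the weights make the two slopes cancel. *)
exists (mix q.2 (- (st z).2)); split.
- by apply: mixval; rewrite ?u0 ?q0 mulr0.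
- by rewrite mixsum; ring.
- by move=> _; exists z1; rewrite ?mixy ?mulf_neq0 ?oppr_eq0 // inE z1in orbT.
Qed.

End Lists.

(** * Solutions on the rooted tree as states at its vertices *)

Section TreeStates.
Variables (R : realType) (G : metric_graph R) (r : vertex G) (T : rooting r).
Implicit Types (x y z v w : vertex G) (g : vertex G -> R * R) (s : R).

Local Notation depth := (depth T).
Local Notation par := (par T).
Local Notation pe := (pe T).
Local Notation ch := (ch T).
Local Notation plen x := (len (pe x)).

(** The fuel [n] only makes the recursion structural; [subtree] supplies enough that the cut-off at
    0 is not reached. *)
Fixpoint grow n x : branch R :=
  stem (plen x) (if n is n'.+1 then [seq grow n' y | y <- ch x] else [::]).

(* The branch hanging from [par x] that starts with the edge [pe x] *)
Definition subtree x := grow (maxdepth T - depth x).+1 x.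

Lemma subtreeE x : x != r -> subtree x = stem (plen x) [seq subtree y | y <- ch x].
Proof.
move=> xr; rewrite {1}/subtree /=; congr stem; apply/eq_in_map => y.
rewrite mem_ch => /andP[yr /eqP yx]; rewrite /subtree.
have := depth_le_max T y; rewrite (depth_par T yr) yx => h.
by congr (grow _ _); lia.
Qed.

Lemma wf_subtree x : x != r -> wf (subtree x).
Proof.
elim/(@up_ind _ _ _ T) => {}x xr IH; rewrite subtreeE //; apply: wf_stem => [|i].
  exact: len_gt0.
rewrite size_map => ic; rewrite (nth_map r) //; apply: IH; exact: mem_nth.
Qed.

Definition node s x : R * R :=
  if ch x is [::] then (0, 1) else pjoins [seq bstate (subtree y) s | y <- ch x].

Lemma bstate_subtree s x : x != r -> bstate (subtree x) s = turn (plen x) s (node s x).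
Proof.
move=> xr; rewrite subtreeE // bstate_stem /node; congr turn.
by case: (ch x) => [//|y ys] /=; rewrite -map_comp.
Qed.

(* [g x] lists the value at [x] and the derivative, divided by [s], of a
   function along [pe x] away from [x]; [up s g x] is the same at [par x], still
   in the direction of [par x]. *)
Definition up s g x := turn (plen x) s (g x).

Definition node_ok s g x : Prop :=
  if ch x == [::] then (g x).1 = 0 else
  {in ch x, forall y, (up s g y).1 = (g x).1} /\
  (g x).2 = \sum_(y <- ch x) (up s g y).2.

Definition solution s g := forall x, x != r -> node_ok s g x.

(** At the root of a branch every solution is proportional to the canonical state. The cross product
    form remains true when that state is (0, 0). *)
Lemma up_proportional s g : solution s g -> forall x, x != r ->
  (up s g x).1 * (bstate (subtree x) s).2 = (up s g x).2 * (bstate (subtree x) s).1.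
Proof.
move=> sol x; elim/(@up_ind _ _ _ T) => {}x xr IH; rewrite bstate_subtree //.
apply: turn_proportional; have := sol x xr; rewrite /node_ok /node.
case: (ch x) IH => [|y ys] IH /=; first by move=> ->; rewrite mul0r mulr0.
move=> [hv ->]; apply: (@pjoins_proportional R _ (fun y => bstate (subtree y) s)
  (y :: ys) (g x).1 (fun y => (up s g y).2)) => z zin.
by rewrite -(hv z zin) IH.
Qed.

(** Uniqueness from the root downwards: a zero state passes through an edge by rotation, and through
    a vertex by [pjoins_zero], as sub-branches of a nondegenerate branch are nondegenerate. *)
Lemma up_zero s g : solution s g -> forall c, c != r -> par c = r ->
  bstate (subtree c) s <> (0, 0) -> up s g c = (0, 0) ->
  ch r = [:: c] -> forall x, x != r -> g x = (0, 0).
Proof.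
move=> sol c cr cp nd uc chr.
suff H x : x != r -> bstate (subtree x) s <> (0, 0) /\ up s g x = (0, 0).
  by move=> x /H [_ E]; apply: (@turn_inj0 R (plen x) s); rewrite -/(up s g x) E.
move: x; apply: (@down_ind _ _ _ T); first by rewrite eqxx.
move=> x xr IH _; have xin : x \in ch (par x) by rewrite mem_ch xr eqxx.
have [pr|pr] := eqVneq (par x) r.
  by move: xin; rewrite pr chr inE => /eqP ->.
have [nd1 u1] := IH pr; set p := par x in xin pr nd1 u1.
have gp : g p = (0, 0) by apply: (@turn_inj0 R (plen p) s); rewrite -/(up s g p) u1.
have nn : node s p <> (0, 0).
  by move=> E; apply: nd1; rewrite bstate_subtree // turn0.
have := sol p pr; rewrite /node_ok; move: nn; rewrite /node.
have unip := ch_uniq T p; case E : (ch p) => [|z zs]; first by rewrite E in xin.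
rewrite -E in unip *; move: unip; set ys := ch p => unip nn.
have -> : (ys == [::]) = false by rewrite /ys E.
rewrite gp => -[hv hs]; have {}hv y : y \in ys -> (up s g y).1 = 0 by exact: hv.
have uz : {in ys, forall y, (up s g y).2 = 0}.
  apply: (@pjoins_zero R _ (fun y => bstate (subtree y) s) ys
     (fun y => (up s g y).2)) => // y yin.
  have yr : y != r by move: yin; rewrite mem_ch => /andP[].
  by rewrite -(up_proportional sol yr) hv // mul0r.
split.
  by move=> E2; apply: nn; exact: (@pjoins_degenerate R _ (fun y => bstate (subtree y) s) ys x).
by rewrite [LHS]surjective_pairing hv // uz.
Qed.

Lemma solution_lin s g h (a b : R) : solution s g -> solution s h ->
  solution s (fun x => (a * (g x).1 + b * (h x).1, a * (g x).2 + b * (h x).2)).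
Proof.
move=> sg sh x xr; have := sg x xr; have := sh x xr; rewrite /node_ok.
case: ifP => _; first by move=> /= -> ->; rewrite !mulr0 addr0.
move=> [hv hs] [gv gs]; split.
  move=> y yx; have e1 : (up s h y).1 = (h x).1 := hv y yx.
  have e2 : (up s g y).1 = (g x).1 := gv y yx.
  by rewrite /= -e1 -e2 /up /turn /=; ring.
rewrite /= gs hs !mulr_sumr -big_split /=; apply: eq_bigr => y _.
by rewrite /up /turn /=; ring.
Qed.

Lemma up_lin s g h (a b : R) x :
  up s (fun x => (a * (g x).1 + b * (h x).1, a * (g x).2 + b * (h x).2)) x =
  (a * (up s g x).1 + b * (up s h x).1, a * (up s g x).2 + b * (up s h x).2).
Proof. by rewrite /up /turn /=; congr (_, _); ring. Qed.

Definition below x y := (depth x <= depth y)%N && (iter (depth y - depth x) par y == x).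

Lemma below_refl x : below x x.
Proof. by rewrite /below leqnn subnn /= eqxx. Qed.

Lemma below_ch x y z : below x y -> z \in ch y -> below x z.
Proof.
rewrite mem_ch /below => /andP[xy /eqP E] /andP[zr /eqP zy].
rewrite (depth_par T zr) zy (leq_trans xy) //= subSn //= -iterS iterSr zy.
by rewrite E eqxx.
Qed.

(** For [y] strictly below [x], the child of [x] on the path to [y]. *)
Definition top x y := iter (depth y - (depth x).+1) par y.

Lemma top_below x y : x != r -> below x y -> y != x -> below (top x y) y /\ top x y \in ch x.
Proof.
move=> xr /andP[xy /eqP E] yx.
have lt : (depth x < depth y)%N.
  rewrite ltn_neqAle xy andbT; apply: contraNneq yx => dxy.
  by move: E; rewrite dxy subnn /= => ->.
have dt : depth (top x y) = (depth x).+1 by rewrite depth_iter ?leq_subr // subKn.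
rewrite /below dt lt /= /top eqxx; split => //.
rewrite mem_ch; apply/andP; split.
  by apply: contraTneq isT => h; move: dt; rewrite /top h depth_root.
by rewrite -iterS -subSn // subSS E.
Qed.

Lemma top_ch x y z : x != r -> below x y -> y != x -> z \in ch y -> top x z = top x y.
Proof.
move=> xr xy yx; rewrite mem_ch => /andP[zr /eqP zy].
have lt : (depth x < depth y)%N.
  case/andP: xy => xy /eqP E; rewrite ltn_neqAle xy andbT.
  by apply: contraNneq yx => dxy; move: E; rewrite dxy subnn /= => ->.
by rewrite /top (depth_par T zr) zy subSn // iterSr zy.
Qed.

Lemma top_of_ch x z : z \in ch x -> top x z = z.
Proof. by rewrite mem_ch => /andP[zr /eqP zx]; rewrite /top (depth_par T zr) zx subnn. Qed.

Lemma below_neq_root x y : x != r -> below x y -> y != r.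
Proof.
move=> xr /andP[xy _]; apply: contraTneq xy => ->.
by rewrite depth_root -ltnNge depth_gt0.
Qed.

Lemma ch_neq x y : y \in ch x -> y != x.
Proof. by rewrite mem_ch => /andP[yr /eqP <-]; rewrite eq_sym par_neq. Qed.

(** At a degenerate frequency the state at the root of the branch is (0, 0), yet a nonzero solution
    exists further down; hence the last clause, which does not say where. The solutions on the
    children are glued with the weights of [pjoins_coef]. *)
Lemma canonical_solution s x : x != r -> exists g,
  [/\ forall y, below x y -> node_ok s g y, up s g x = bstate (subtree x) s &
      exists2 y, below x y & g y <> (0, 0)].
Proof.
elim/(@up_ind _ _ _ T) => {}x xr IH.
have [chx|chx] := eqVneq (ch x) [::].
  exists (fun y => if y == x then (0, 1) else (0, 0)); split.
  - move=> y xy; rewrite /node_ok; have [->|yx] := eqVneq y x; first by rewrite chx eqxx.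
    by have [_] := top_below xr xy yx; rewrite chx.
  - by rewrite /up eqxx bstate_subtree // /node chx.
  - exists x; first exact: below_refl.
    by rewrite eqxx => -[] /eqP; rewrite oner_eq0.
have /choice [gg hgg] : forall z, exists g, z \in ch x ->
    [/\ forall y, below z y -> node_ok s g y, up s g z = bstate (subtree z) s &
      exists2 y, below z y & g y <> (0, 0)].
  move=> z; have [zx|//] := boolP (z \in ch x).
    by have [g hg] := IH z zx; exists g.
  by exists (fun=> (0, 0)).
have [al [av asum anz]] := @pjoins_coef R _ (fun y => bstate (subtree y) s) _ (ch_uniq T x).
pose sc (a : R) (p : R * R) := (a * p.1, a * p.2).
pose g y := if y == x then node s x else sc (al (top x y)) (gg (top x y) y).
have nodeE : node s x = pjoins [seq bstate (subtree y) s | y <- ch x].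
  by rewrite /node; case: (ch x) chx.
have up_sc a h y : up s (fun w => sc a (h w)) y = sc a (up s h y).
  by rewrite /up /turn /sc /=; congr (_, _); ring.
have gE y : y != x -> g y = sc (al (top x y)) (gg (top x y) y).
  by move=> yx; rewrite /g (negbTE yx).
have upg z : z != x -> up s g z = sc (al (top x z)) (up s (gg (top x z)) z).
  by move=> zx; rewrite -up_sc /up gE.
have upch z : z \in ch x -> up s g z = sc (al z) (bstate (subtree z) s).
  move=> zx; rewrite upg ?(ch_neq zx) // top_of_ch //.
  by have [_ -> _] := hgg z zx.
exists g; split.
- move=> y xy; rewrite /node_ok; have [->|yx] := eqVneq y x.
    rewrite (negbTE chx) /g eqxx; split.
      by move=> z zx; rewrite -/g upch //= nodeE av.
    rewrite -/g nodeE -asum; apply: eq_big_seq => z zx.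
    by rewrite upch.
  have [ty tx] := top_below xr xy yx.
  have [/(_ y ty) + _ _] := hgg _ tx; rewrite /node_ok gE //.
  case: ifP => _; first by rewrite /sc /= => ->; rewrite mulr0.
  have upz z : z \in ch y -> up s g z = sc (al (top x y)) (up s (gg (top x y)) z).
    move=> zy; rewrite upg; last first.
      have := below_ch xy zy; have := below_neq_root xr xy.
      move: zy; rewrite mem_ch => /andP[zr /eqP zp] yr _.
      by apply: contraTneq xy => zx; rewrite /below -zx (depth_par T zr) zp ltnn.
    by rewrite (top_ch xr xy yx zy).
  move=> [hv hs]; split.
    move=> z zy; rewrite upz //.
    exact: (congr1 (fun t => al (top x y) * t) (hv z zy)).
  rewrite [LHS](congr1 (fun t => al (top x y) * t) hs) mulr_sumr.
  by apply: eq_big_seq => z zy; rewrite upz.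
- by rewrite /up /g eqxx bstate_subtree.
- have [z zx az] := anz chx; have [_ _ [y zy gy]] := hgg z zx.
  have xy : below x y.
    case/andP: zy => dz /eqP E; move: (zx); rewrite mem_ch => /andP[zr /eqP zp].
    have dx : depth z = (depth x).+1 by rewrite (depth_par T zr) zp.
    rewrite dx in dz E; rewrite /below ltnW //=.
    have -> : (depth y - depth x = (depth y - (depth x).+1).+1)%N by lia.
    by rewrite iterS E zp.
  have yx : y != x.
    apply: contraTneq zy => ->; rewrite /below.
    by move: (zx); rewrite mem_ch => /andP[zr /eqP zp]; rewrite (depth_par T zr) zp ltnn.
  have tE : top x y = z.
    case/andP: zy => dz /eqP E; move: (zx); rewrite mem_ch => /andP[zr /eqP zp].
    by rewrite /top -E (depth_par T zr) zp.
  exists y => //; rewrite gE // tE /sc.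
  case: (gg z y) gy => a b /= gy [] /eqP; rewrite mulf_eq0 (negbTE az) /= => /eqP a0.
  by move=> /eqP; rewrite mulf_eq0 (negbTE az) /= => /eqP b0; apply: gy; rewrite a0 b0.
Qed.

End TreeStates.

(** * Modes of different eigenvalues on one edge *)

Section TwoModes.
Variable R : realType.
Implicit Types (l x : R) (f h : R -> R).

Lemma is_derive_vanish l f (d : R -> R) :
  (forall x, 0 < x < l -> is_derive x 1 f (d x)) ->
  (forall x, 0 < x < l -> f x = 0) -> forall x, 0 < x < l -> d x = 0.
Proof.
move=> df f0 x xl; have h0 : is_derive x 1 f 0.
  apply: near_eq_is_derive (is_derive_cst 0 x 1).
  have := @near_in_itvoo R 0 l x; rewrite in_itv /= => /(_ xl).
  by apply: filterS => y; rewrite in_itv /= => /f0.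
by case: (df x xl) => _ <-; case: h0.
Qed.

(** Differentiating the relation twice gives a second one with coefficients [lam] and [mu], and the
    two together eliminate [h]. *)
Lemma distinct_modes l lam mu f f1 h h1 (a b : R) : 0 < l -> lam != mu ->
  edge_ode l lam f f1 -> edge_ode l mu h h1 ->
  (forall x, 0 <= x <= l -> a * f x + b * h x = 0) ->
  forall x, 0 <= x <= l -> a * f x = 0.
Proof.
move=> l0 lm [cf _ df df1] [ch _ dh dh1] z.
have lin (p q dp dq : R -> R) : (forall x, 0 < x < l -> is_derive x 1 p (dp x)) ->
    (forall x, 0 < x < l -> is_derive x 1 q (dq x)) ->
    forall x, 0 < x < l -> is_derive x 1 (fun x => a * p x + b * q x) (a * dp x + b * dq x).
  move=> hp hq x xl.
  have k := is_deriveD (is_deriveM (is_derive_cst a x 1) (hp x xl))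
    (is_deriveM (is_derive_cst b x 1) (hq x xl)).
  by refine (is_derive_eq k _); rewrite /GRing.scale /=; ring.
have z0 x : 0 < x < l -> a * f x + b * h x = 0.
  by move=> /andP[x0 xl]; apply: z; rewrite !ltW.
have z1 := is_derive_vanish (lin _ _ _ _ df dh) z0.
have z2 := is_derive_vanish (lin _ _ _ _ df1 dh1) z1.
have af x : 0 < x < l -> a * f x = 0.
  move=> xl; have := z2 x xl; have := z0 x xl => e1 e2.
  have : (mu - lam) * (a * f x) = 0.
    transitivity (a * (- lam * f x) + b * (- mu * h x) + mu * (a * f x + b * h x)).
      by ring.
    by rewrite e1 e2 mulr0 addr0.
  move/eqP; rewrite mulf_eq0 subr_eq0 eq_sym (negbTE lm) /=.
  by move/eqP.
have caf : {within `[0, l], continuous (fun x => a * f x)}.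
  by move=> x; apply: cvgM; [exact: cvg_cst|exact: cf].
have daf x : 0 < x < l -> is_derive x 1 (fun x => a * f x) 0.
  move=> xl; apply: near_eq_is_derive (is_derive_cst 0 x 1).
  have := @near_in_itvoo R 0 l x; rewrite in_itv /= => /(_ xl).
  by apply: filterS => y; rewrite in_itv /= => /af.
have cst_af := constant_on_segment l0 caf daf.
have h2 : 0 < l / 2 < l by rewrite divr_gt0 //= ltr_pdivrMr // ltr_pMr // ltr1n.
move=> x xl; rewrite (cst_af x xl) -(cst_af (l / 2)) ?af //.
by case/andP: h2 => /ltW -> /ltW ->.
Qed.

End TwoModes.

(** * Counting one and two eigenvalues *)

Section Eigenfunctions.
Variables (R : realType) (G : metric_graph R).
Implicit Types (f h : edge G -> R -> R).

Definition nonzero f := exists e x, 0 <= x <= len e /\ f e x != 0.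

Lemma in_eigenspaceP lam f : in_eigenspace lam f -> exists f1 phi,
  [/\ forall e, edge_ode (len e) lam (f e) (f1 e),
      continuous_at_vertices f phi,
      forall v, leaf v -> phi v = 0 &
      forall v, ~~ leaf v -> flux f1 v = 0].
Proof.
move=> [f1 [f2 [phi [H cv dl kf ae]]]]; exists f1, phi; split => // e.
by have [H1 H2] := H e; apply: (H1_edge_ode (len_gt0 e) H1 H2); exact: ae.
Qed.

Lemma eigenvalue_count1 (P : set R) lam f : P lam -> in_eigenspace lam f ->
  nonzero f -> eigenvalue_count_ge G P 1.
Proof.
move=> Pl Hf [e [x [xl fx]]]; exists (fun=> lam), (fun=> f); split => // c hc i.
rewrite [i]ord1; have := hc e x xl; rewrite big_ord_recl big_ord0 addr0 => /eqP.
by rewrite mulf_eq0 (negbTE fx) orbF => /eqP.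
Qed.

Lemma eigenvalue_count1_inv (P : set R) : eigenvalue_count_ge G P 1 ->
  exists lam f, [/\ P lam, in_eigenspace lam f & nonzero f].
Proof.
move=> [lam [f [H ind]]]; exists (lam ord0), (f ord0).
have [Pl Hf] := H ord0; split=> //; apply/not_existsP => nz.
have h : forall i : 'I_1, (1 : R) = 0; last by move/eqP: (h ord0); rewrite oner_eq0.
apply: (ind (fun=> 1)) => e x xl; rewrite big_ord_recl big_ord0 addr0 mul1r.
by apply/eqP; apply: contrapT => /negP fx; apply: (nz e); exists x.
Qed.

Lemma eigenvalue_count2 (P : set R) lam mu f h : lam != mu -> P lam -> P mu ->
  in_eigenspace lam f -> in_eigenspace mu h -> nonzero f -> nonzero h ->
  eigenvalue_count_ge G P 2.
Proof.
move=> lm Pl Pm Hf Hh nf nh.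
exists (fun i : 'I_2 => if i == ord0 then lam else mu).
exists (fun i : 'I_2 => if i == ord0 then f else h).
split; first by move=> i; case: ifP.
move=> c hc.
have E e x : 0 <= x <= len e -> c ord0 * f e x + c (lift ord0 ord0) * h e x = 0.
  by move=> /(hc e x); rewrite !big_ord_recl big_ord0 addr0 /=.
have [f1 [phi [of_ _ _ _]]] := in_eigenspaceP Hf.
have [h1 [psi [oh _ _ _]]] := in_eigenspaceP Hh.
have c0 : c ord0 = 0.
  have [e [x [xl fx]]] := nf.
  have /eqP := distinct_modes (len_gt0 e) lm (of_ e) (oh e) (E e) xl.
  by rewrite mulf_eq0 (negbTE fx) orbF => /eqP.
have c1 : c (lift ord0 ord0) = 0.
  have [e [x [xl hx]]] := nh; have ml : mu != lam by rewrite eq_sym.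
  have E' y : 0 <= y <= len e -> c (lift ord0 ord0) * h e y + c ord0 * f e y = 0.
    by move=> /E; rewrite addrC.
  have /eqP := distinct_modes (len_gt0 e) ml (oh e) (of_ e) E' xl.
  by rewrite mulf_eq0 (negbTE hx) orbF => /eqP.
by move=> i; case: (unliftP ord0 i) => [j|] ->; rewrite ?c0 // ord1.
Qed.

Lemma eigenvalue_count2_inv (P : set R) : eigenvalue_count_ge G P 2 ->
  exists lam mu f h, [/\ P lam, P mu, in_eigenspace lam f, in_eigenspace mu h &
    forall a b, (forall e x, 0 <= x <= len e -> a * f e x + b * h e x = 0) ->
      a = 0 /\ b = 0].
Proof.
move=> [lam [f [H ind]]]; pose i1 : 'I_2 := lift ord0 ord0.
exists (lam ord0), (lam i1), (f ord0), (f i1).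
have [P0 H0] := H ord0; have [P1 H1] := H i1; split=> // a b ab.
have h := ind (fun i => if i == ord0 then a else b).
have {}h : forall i : 'I_2, (if i == ord0 then a else b) = 0.
  by apply: h => e x /ab; rewrite !big_ord_recl big_ord0 addr0.
by split; [have := h ord0|have := h i1].
Qed.

Lemma lin_indep_nonzero f h :
  (forall a b : R, (forall e x, 0 <= x <= len e -> a * f e x + b * h e x = 0) ->
      a = 0 /\ b = 0) -> nonzero f /\ nonzero h.
Proof.
move=> ind; split; apply/not_existsP => nz.
  have [|] := ind 1 0; last by move/eqP; rewrite oner_eq0.
  move=> e x xl; rewrite mul1r mul0r addr0.
  by apply/eqP; apply: contrapT => /negP fx; apply: (nz e); exists x.
have [|_] := ind 0 1; last by move/eqP; rewrite oner_eq0.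
move=> e x xl; rewrite mul1r mul0r add0r.
by apply/eqP; apply: contrapT => /negP fx; apply: (nz e); exists x.
Qed.

End Eigenfunctions.

(** * Correspondence between vertex states and eigenfunctions *)

Section Spectrum.
Variables (R : realType) (G : metric_graph R) (r : vertex G) (T : rooting r).
Implicit Types (x y z v w : vertex G) (g : vertex G -> R * R) (s : R).

Local Notation par := (par T).
Local Notation pe := (pe T).
Local Notation pv := (pv T).
Local Notation ch := (ch T).
Local Notation fwd := (fwd T).
Local Notation plen x := (len (pe x)).

(** Initial data at coordinate 0 of the edge. If that end is the parent, the slope in [up], which
    points towards the parent, changes sign. *)
Definition start s g y : R * R :=
  if fwd y then g y else ((up T s g y).1, - (up T s g y).2).

Definition extend s g (e : edge G) (t : R) : R :=
  (start s g (pv e)).1 * cos (t * s) + (start s g (pv e)).2 * sin (t * s).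

Definition extend' s g (e : edge G) (t : R) : R :=
  s * ((start s g (pv e)).2 * cos (t * s) - (start s g (pv e)).1 * sin (t * s)).

Lemma extend_ends s g y : y != r ->
  (if fwd y then extend s g (pe y) 0 = (g y).1 /\
     extend s g (pe y) (plen y) = (up T s g y).1
   else extend s g (pe y) 0 = (up T s g y).1 /\
     extend s g (pe y) (plen y) = (g y).1) /\
  into T (extend' s g) y = - (s * (g y).2) /\ out T (extend' s g) y = s * (up T s g y).2.
Proof.
move=> yr; rewrite /into /out /extend /extend' peK // /start.
have -> : plen y * s = s * plen y by rewrite mulrC.
rewrite /up /turn; set c := cos (s * plen y); set d := sin (s * plen y).
have cd : c ^+ 2 + d ^+ 2 = 1 := cos2Dsin2 _.
case: (fwd y) => /=; rewrite !mul0r cos0 sin0 !mulr1 !mulr0 addr0 subr0 //.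
split; split => //.
- by rewrite -[RHS]mulr1 -cd; ring.
- by rewrite -[X in _ = - (_ * X)]mulr1 -cd; ring.
- by rewrite mulrN opprK.
Qed.

Lemma extend_eigen s g : 0 < s -> leaf r -> solution T s g ->
  {in ch r, forall c, (up T s g c).1 = 0} -> in_eigenspace (s ^+ 2) (extend s g).
Proof.
move=> s0 lr sol gr.
exists (extend' s g), (fun e t => - (s ^+ 2) * extend s g e t),
  (fun v => if v == r then 0 else (g v).1).
have upv y : y != r -> (up T s g y).1 = if par y == r then 0 else (g (par y)).1.
  move=> yr; have yin : y \in ch (par y) by rewrite mem_ch yr eqxx.
  case: eqVneq => [pr|pr]; first by apply: gr; move: yin; rewrite pr.
  have := sol _ pr; rewrite /node_ok.
  by case: eqP yin => [->//|_ yin [hv _]]; exact: hv.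
split.
- by move=> e; have [h1 h2] := trig_H1 s (start s g (pv e)).1 (start s g (pv e)).2 (len_gt0 e).
- move=> e; rewrite -(pvK T e); move: (pv e) (pv_neq T e) => y yr.
  have := pe_ends T yr; have [+ _] := extend_ends s g yr.
  by case: (fwd y) => -[-> ->] [-> ->]; rewrite (negbTE yr) upv.
- move=> v; case: eqVneq => [//|vr] lv; have := sol v vr; rewrite /node_ok.
  by rewrite -(leaf_rooted T vr) lv.
- move=> v nl; have vr : v != r by apply: contraNneq nl => ->.
  rewrite (flux_rooted T) //; have [_ [-> _]] := extend_ends s g vr.
  have := sol v vr; rewrite /node_ok -(leaf_rooted T vr) (negbTE nl) => -[_ ->].
  rewrite mulr_sumr addrC; apply/eqP; rewrite subr_eq0; apply/eqP.
  apply: eq_big_seq => y; rewrite mem_ch => /andP[yr _].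
  by have [_ [_ ->]] := extend_ends s g yr.
- move=> e; apply: filterE; first exact: (ae_filter_ringOfSetsType lebesgue_measure).
  by move=> t _; rewrite mulNr opprK.
Qed.

Lemma extend_nonzero s g y : 0 < s -> y != r -> g y <> (0, 0) -> nonzero (extend s g).
Proof.
move=> s0 yr gy; apply/not_existsP => nz.
have z e t : 0 <= t <= len e -> extend s g e t = 0.
  move=> tl; apply/eqP; apply: contrapT => /negP fx; apply: (nz e); by exists t.
set a := (start s g y).1; set b := (start s g y).2.
have st0 : a = 0 /\ b = 0.
  have l0 := len_gt0 (pe y).
  have ab t : 0 <= t <= plen y -> a * cos (t * s) + b * sin (t * s) = 0.
    by move=> /(z (pe y)); rewrite /extend peK.
  have a0 : a = 0.
    have := ab 0; rewrite lexx (ltW l0) mul0r cos0 sin0 mulr1 mulr0 addr0.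
    by apply.
  split=> //; pose t := Num.min (plen y) (pi / 2 / s).
  have t0 : 0 < t by rewrite lt_min l0 !divr_gt0 ?pi_gt0.
  have : 0 < sin (t * s).
    rewrite sin_gt0_pi // mulr_gt0 //=.
    have : t <= pi / 2 / s by rewrite ge_min lexx orbT.
    by rewrite ler_pdivlMr //; have := pi_gt0 R; lra.
  have := ab t; rewrite (ltW t0) ge_min lexx a0 mul0r add0r => /(_ isT) /eqP.
  by rewrite mulf_eq0 => /orP[/eqP //|/eqP ->]; rewrite ltxx.
move: st0; rewrite /a /b /start; case: (fwd y) => /=.
  by case: (g y) gy => p q /= gy [p0 q0]; apply: gy; rewrite p0 q0.
move=> [p0 /eqP]; rewrite oppr_eq0 => /eqP q0; apply: gy.
exact: (@turn_inj0 R (plen y) s).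
Qed.

Lemma extend_lin s g h (a b : R) e t :
  extend s (fun x => (a * (g x).1 + b * (h x).1, a * (g x).2 + b * (h x).2)) e t =
  a * extend s g e t + b * extend s h e t.
Proof.
rewrite /extend /start; case: (fwd _); first by rewrite /=; ring.
by rewrite up_lin /=; ring.
Qed.

Lemma extend_zero s g e t : (forall x, x != r -> g x = (0, 0)) -> extend s g e t = 0.
Proof.
move=> g0; rewrite /extend /start; have gp := g0 _ (pv_neq T e).
case: (fwd _); first by rewrite gp /= !mul0r addr0.
by rewrite /up (turn0 _ _ gp) /= oppr0 !mul0r addr0.
Qed.

Lemma eigen_solution s f : 0 < s -> leaf r -> in_eigenspace (s ^+ 2) f ->
  exists g, [/\ solution T s g, {in ch r, forall c, (up T s g c).1 = 0} &
    forall e t, 0 <= t <= len e -> f e t = extend s g e t].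
Proof.
move=> s0 lr /in_eigenspaceP [f1 [phi [ode cv dl kf]]].
pose g y := (phi y, - (into T f1 y) / s).
have trig y : y != r -> [/\ up T s g y = (phi (par y), out T f1 y / s) &
    start s g y = (f (pe y) 0, f1 (pe y) 0 / s)].
  move=> yr; have l0 := len_gt0 (pe y).
  have ll : 0 <= plen y <= plen y by rewrite lexx ltW.
  have [h1 h2] := edge_ode_trig l0 s0 (ode (pe y)) ll.
  have [e0 e1] := cv (pe y); have := pe_ends T yr.
  have cd := cos2Dsin2 (plen y * s).
  rewrite /start /up /turn /g /into /out [s * plen y]mulrC.
  move: h1 h2; set c := cos _ in cd *; set d := sin _ in cd * => h1 h2.
  case: (fwd y) => -[sy ty]; rewrite /=.
    have -> : phi y = f (pe y) 0 by rewrite e0 sy.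
    have -> : phi (par y) = f (pe y) (plen y) by rewrite e1 ty.
    by rewrite opprK h1 h2; split.
  have -> : phi y = f (pe y) (plen y) by rewrite e1 ty.
  have -> : phi (par y) = f (pe y) 0 by rewrite e0 sy.
  rewrite !mulNr h2 h1.
  split; congr (_, _).
  - by rewrite -[RHS]mulr1 -cd; ring.
  - by rewrite -[RHS]mulr1 -cd; ring.
  - by rewrite -[RHS]mulr1 -cd; ring.
  - by rewrite -[RHS]mulr1 -cd; ring.
exists g; split.
- move=> y yr; rewrite /node_ok -(leaf_rooted T yr); case: ifP => ly; first exact: dl.
  have upy z : z \in ch y -> up T s g z = (phi y, out T f1 z / s).
    by rewrite mem_ch => /andP[zr /eqP <-]; have [] := trig z zr.
  split; first by move=> z /upy Ez; exact: (congr1 fst Ez).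
  have := kf y (negbT ly); rewrite (flux_rooted T) // => /eqP.
  rewrite addrC addr_eq0 => /eqP E; rewrite [LHS]/= -E mulr_suml.
  by apply: eq_big_seq => z /upy ->.
- move=> c; rewrite mem_ch => /andP[cr /eqP cp]; have [-> _] := trig c cr.
  by rewrite /= cp dl.
- move=> e t tl; rewrite -{1}(pvK T e) /extend.
  have [_ ->] := trig _ (pv_neq T e); rewrite (pvK T e) /=.
  by have [] := edge_ode_trig (len_gt0 e) s0 (ode e) tl.
Qed.

End Spectrum.

(** * Explicit spectra of the extremal trees *)

Section StarBranches.
Variable R : realType.
Implicit Types (B : branch R) (k l s : R).

Lemma cos_eq0 (x : R) : 0 < x < pi -> cos x = 0 -> x = pi / 2.
Proof.
move=> /andP[x0 xp] cx; have p0 := pi_gt0 R.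
apply: cos_inj; rewrite ?in_itv /= ?cos_pihalf //; apply/andP; split; lra.
Qed.

Lemma star_bstate n l s : bstate (joinl (Edge l) (nseq n (Edge l))) s =
  (sin (s * l) ^+ n.+1, n.+1%:R * cos (s * l) * sin (s * l) ^+ n).
Proof.
elim: n => [|n IH] /=; first by rewrite expr1 expr0 mul1r mulr1.
by rewrite IH /=; congr (_, _); rewrite ?[n.+2%:R]mulrSr ?exprS; ring.
Qed.

Lemma star_bval n l s : bval (Ext l (joinl (Edge l) (nseq n (Edge l)))) s =
  n.+2%:R * cos (s * l) * sin (s * l) ^+ n.+1.
Proof.
rewrite bval_Ext /bval /bder star_bstate /= [n.+2%:R]mulrSr exprS; ring.
Qed.

(** For [0 < s * l < pi] only the cosine can vanish, so the first zero has [s * l = pi / 2] and the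
    next one, due to the sine, [s * l = pi]. *)
Lemma star_zeros n l k : 0 < l -> 0 < k ->
  let u := bval (Ext l (joinl (Edge l) (nseq n (Edge l)))) in
  u k = 0 -> (forall s, 0 < s < k -> u s != 0) ->
  u (2 * k) = 0 /\ forall s, k < s < 2 * k -> u s != 0.
Proof.
move=> l0 k0 u uk nz; have p0 := pi_gt0 R.
have uE s : u s = n.+2%:R * cos (s * l) * sin (s * l) ^+ n.+1 by exact: star_bval.
have u0 s : 0 < s * l < pi -> u s = 0 -> s * l = pi / 2.
  move=> sl; rewrite uE => /eqP; rewrite mulf_eq0 expf_eq0 /=.
  rewrite (gt_eqF (sin_gt0_pi sl)) orbF mulf_eq0 pnatr_eq0 /= => /eqP.
  exact: cos_eq0.
have kl0 : 0 < k * l by exact: mulr_gt0.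
have kl : k * l = pi / 2.
  have [h|h] := ltP (k * l) pi; first by apply: u0 => //; rewrite kl0.
  exfalso; have := nz (pi / 2 / l); rewrite divr_gt0 ?divr_gt0 // ltr_pdivrMr //.
  rewrite (_ : pi / 2 < k * l) ?uE; last by lra.
  have ln0 : l != 0 by rewrite gt_eqF.
  by rewrite divfK // cos_pihalf mulr0 mul0r eqxx => /(_ isT).
split.
  rewrite uE; have -> : 2 * k * l = pi by lra.
  by rewrite sinpi expr0n mulr0.
move=> s /andP[ks s2]; apply/eqP => us.
have sl1 : k * l < s * l by rewrite ltr_pM2r.
have sl2 : s * l < 2 * k * l by rewrite ltr_pM2r.
have /u0/(_ us) : 0 < s * l < pi by apply/andP; split; lra.
lra.
Qed.

Lemma edge_zeros l k : 0 < l -> 0 < k -> let u := bval (Edge l) in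
  u k = 0 -> (forall s, 0 < s < k -> u s != 0) ->
  u (2 * k) = 0 /\ forall s, k < s < 2 * k -> u s != 0.
Proof.
move=> l0 k0 u uk nz; have p0 := pi_gt0 R.
have kl0 : 0 < k * l by exact: mulr_gt0.
have kl : k * l = pi.
  apply/eqP; rewrite eq_le; apply/andP; split; rewrite leNgt; apply/negP => h.
    have := nz (pi / l); rewrite divr_gt0 // ltr_pdivrMr // h /u bval_Edge.
    have ln0 : l != 0 by rewrite gt_eqF.
    by rewrite divfK // sinpi eqxx => /(_ isT).
  by move: uk; rewrite /u bval_Edge => /eqP; rewrite gt_eqF // sin_gt0_pi // kl0.
split.
  rewrite /u bval_Edge; have -> : 2 * k * l = pi + pi by lra.
  by rewrite sinD sinpi mul0r mulr0 addr0.
move=> s /andP[ks s2]; apply/eqP => us.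
have sl1 : k * l < s * l by rewrite ltr_pM2r.
have sl2 : s * l < 2 * k * l by rewrite ltr_pM2r.
have : 0 < sin (s * l - pi) by apply: sin_gt0_pi; apply/andP; split; lra.
rewrite sinB sinpi cospi mulr0 subr0 -bval_Edge -/u us mul0r ltxx //.
Qed.

Lemma flat_joinl k B Bs : flat k (joinl B Bs) ->
  forall i, (i < (size Bs).+1)%N -> flat k (nth B (B :: Bs) i).
Proof.
elim: Bs B => [|C Cs IH] B /=; first by move=> h [].
move=> [hB hC] [|i] //= iC; have := IH C hC i iC; rewrite (set_nth_default B) //.
Qed.

Lemma pos_joinl k B Bs : pos k (joinl B Bs) ->
  forall i, (i < (size Bs).+1)%N -> pos k (nth B (B :: Bs) i).
Proof.
elim: Bs B => [|C Cs IH] B /=; first by move=> h [].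
move=> [hB hC] [|i] //= iC; have := IH C hC i iC; rewrite (set_nth_default B) //.
Qed.

Lemma flat_Edge k l : 0 < l -> 0 < k -> pos k (Edge l) -> flat k (Edge l) -> k * l = pi / 2.
Proof.
move=> l0 k0 p [_]; rewrite bder_Edge; apply: cos_eq0; rewrite mulr_gt0 //= ltNge.
apply/negP => h; have := p (pi / l).
by rewrite divr_gt0 ?pi_gt0 //= ler_pdivrMr // h bval_Edge divfK ?gt_eqF // sinpi ltxx => /(_ isT).
Qed.

End StarBranches.

(** * Spectrum and extremal shape of a tree rooted at a leaf *)

Section LeafRooted.
Variables (R : realType) (G : metric_graph R) (r c : vertex G) (T : rooting r).
Hypotheses (lr : leaf r) (chr : ch T r = [:: c]).
Implicit Types (x y z v w : vertex G) (s lam : R) (f h : edge G -> R -> R).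

Local Notation par := (par T).
Local Notation pe := (pe T).
Local Notation pv := (pv T).
Local Notation ch := (ch T).
Local Notation subtree := (subtree T).
Local Notation plen x := (len (pe x)).

Lemma child_neq : c != r.
Proof.
by have := mem_head c [::]; rewrite -chr mem_ch => /andP[].
Qed.

Lemma child_par : par c = r.
Proof.
by have := mem_head c [::]; rewrite -chr mem_ch => /andP[_ /eqP].
Qed.

Lemma below_child y : y != r -> below T c y.
Proof.
move: y; apply: (@down_ind _ _ _ T); first by rewrite eqxx.
move=> y yr IH _; have yin : y \in ch (par y) by rewrite mem_ch yr eqxx.
have [pr|pr] := eqVneq (par y) r.
  by move: yin; rewrite pr chr inE => /eqP ->; exact: below_refl.
exact: below_ch (IH pr) yin.
Qed.

(** Energy identity: the increments of [f * f'] over the edges sum to the vertex values times the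
    fluxes, which is 0. By [edge_ode_nonpos] no increment is negative, so [f] is constant on edges,
    and it vanishes at the root. *)
Lemma eigen_nonpos lam f : lam <= 0 -> in_eigenspace lam f ->
  forall e t, 0 <= t <= len e -> f e t = 0.
Proof.
move=> lam0 /in_eigenspaceP [f1 [phi [ode cv dl kf]]].
have mono e := edge_ode_nonpos (len_gt0 e) lam0 (ode e).
have sum0 : \sum_e (f e (len e) * f1 e (len e) - f e 0 * f1 e 0) = 0.
  transitivity (\sum_v phi v * flux f1 v); last first.
    rewrite big1 // => v _; have [lv|nv] := boolP (leaf v); first by rewrite dl // mul0r.
    by rewrite kf // mulr0.
  under [RHS]eq_bigr do rewrite /flux mulrBr !mulr_sumr.
  rewrite sumrB sumrB; congr (_ - _).
    rewrite (partition_big (@tgt R G) predT) //=; apply: eq_bigr => v _.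
    by apply: eq_bigr => e /eqP <-; have [_ ->] := cv e.
  rewrite (partition_big (@src R G) predT) //=; apply: eq_bigr => v _.
  by apply: eq_bigr => e /eqP <-; have [-> _] := cv e.
have cst_edge e : forall t, 0 <= t <= len e -> f e t = f e 0.
  have [_] := mono e; apply; apply/esym/eqP; rewrite -subr_eq0; apply/eqP.
  have /psumr_eq0P h : forall e, true -> 0 <= f e (len e) * f1 e (len e) - f e 0 * f1 e 0.
    by move=> e' _; rewrite subr_ge0; have [] := mono e'.
  exact: h.
have phi0 : forall v, phi v = 0.
  apply: (@down_ind _ _ _ T); first exact: dl.
  move=> y yr <-; have l0 := len_gt0 (pe y).
  have [e0 e1] := cv (pe y); have := pe_ends T yr.
  have E := cst_edge (pe y) (plen y); rewrite lexx (ltW l0) in E.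
  by case: (fwd T y) => -[sy ty]; rewrite sy in e0; rewrite ty in e1;
    rewrite -e0 -e1 E.
by move=> e t tl; rewrite cst_edge //; have [-> _] := cv e; exact: phi0.
Qed.

Lemma zero_eigen s : 0 < s -> bval (subtree c) s = 0 ->
  exists2 f, @in_eigenspace R G (s ^+ 2) f & @nonzero R G f.
Proof.
move=> s0 us; have [g [ok ug [y yc gy]]] := canonical_solution T s child_neq.
exists (extend T s g).
  apply: extend_eigen => //; first by move=> x xr; apply: ok; exact: below_child.
  by move=> z; rewrite chr inE => /eqP ->; rewrite ug.
exact: (extend_nonzero T s0 (below_neq_root child_neq yc) gy).
Qed.

(** If the branch had a nonzero value at the root, proportionality would make the slope of the
    eigenfunction vanish there too, and [up_zero] would make it zero everywhere. *)
Lemma eigen_zero lam f : in_eigenspace lam f -> nonzero f ->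
  0 < lam /\ bval (subtree c) (Num.sqrt lam) = 0.
Proof.
move=> Hf nf; have lam0 : 0 < lam.
  rewrite ltNge; apply/negP => lam0; have [e [x [xl /eqP[]]]] := nf.
  exact: eigen_nonpos Hf e x xl.
split=> //; set s := Num.sqrt lam; have s0 : 0 < s by rewrite sqrtr_gt0.
have Hs : in_eigenspace (s ^+ 2) f by rewrite sqr_sqrtr // ltW.
have [g [sol gr fE]] := eigen_solution T s0 lr Hs.
apply/eqP; apply: contrapT => /negP us.
have gc1 : (up T s g c).1 = 0 by apply: gr; rewrite chr mem_head.
have gc2 : (up T s g c).2 = 0.
  have := up_proportional sol child_neq; rewrite gc1 mul0r => /esym/eqP.
  by rewrite mulf_eq0 (negbTE us : (bstate _ _).1 == 0 = false) orbF => /eqP.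
have [e [x [xl /eqP[]]]] := nf; rewrite fE //; apply: extend_zero.
apply: (up_zero sol child_neq child_par _ _ chr).
  by move=> E; move: us; rewrite /bval E eqxx.
by rewrite [LHS]surjective_pairing gc1 gc2.
Qed.

(** In the nondegenerate case an eigenfunction is determined by its slope at the root leaf, and two
    slopes are always dependent. *)
Lemma simple_eigen s f h : 0 < s -> bstate (subtree c) s <> (0, 0) ->
  in_eigenspace (s ^+ 2) f -> in_eigenspace (s ^+ 2) h ->
  ~ (forall a b : R, (forall e t, 0 <= t <= len e -> a * f e t + b * h e t = 0) ->
      a = 0 /\ b = 0).
Proof.
move=> s0 nd Hf Hh ind.
have [g [sg gr fE]] := eigen_solution T s0 lr Hf.
have [k [sk kr hE]] := eigen_solution T s0 lr Hh.
have gc : (up T s g c).1 = 0 by apply: gr; rewrite chr mem_head.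
have kc : (up T s k c).1 = 0 by apply: kr; rewrite chr mem_head.
have dep a b : a * (up T s g c).2 + b * (up T s k c).2 = 0 -> a = 0 /\ b = 0.
  move=> E; apply: ind => e x xl; rewrite fE // hE // -extend_lin.
  apply: extend_zero; apply: (up_zero (solution_lin a b sg sk) child_neq child_par nd _ chr).
  by rewrite up_lin gc kc E !mulr0 addr0.
have [|k0 /eqP] := dep (up T s k c).2 (- (up T s g c).2); first by ring.
rewrite oppr_eq0 => /eqP g0.
have [|/eqP] := dep 1 1; first by rewrite g0 k0 !mulr0 addr0.
by rewrite oner_eq0.
Qed.

(** The equality cases as seen from the root leaf: [c] is the other end of the interval or the
    centre of the star. *)
Definition star_like : Prop :=
  ch c = [::] \/ {in ch c, forall z, ch z = [::] /\ plen z = plen c}.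

Lemma interval_rooted : ch c = [::] -> interval_graph G.
Proof.
move=> cc; have yc y : y != r -> y = c.
  move=> yr; apply: contrapT => /eqP yc.
  have [_] := top_below child_neq (below_child yr) yc; by rewrite cc.
exists (pe c), c, r; split.
- exact: child_neq.
- by have := pe_joins T child_neq; rewrite child_par.
- by move=> e; rewrite -(pvK T e) (yc _ (pv_neq T e)).
- by move=> w; have [->|/yc ->] := eqVneq w r; [right|left].
Qed.

Lemma star_rooted : {in ch c, forall z, ch z = [::] /\ plen z = plen c} ->
  ch c != [::] -> equilateral_star_graph G.
Proof.
move=> cc cn; have yc y : y != r -> y = c \/ y \in ch c.
  move=> yr; have [->|yc] := eqVneq y c; [by left|right].
  have [ty tc] := top_below child_neq (below_child yr) yc.
  have [E|yt] := eqVneq y (top T c y); first by rewrite E.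
  have tr : top T c y != r by move: tc; rewrite mem_ch => /andP[].
  have [_] := top_below tr ty yt; by have [-> _] := cc _ tc.
have zr z : z \in ch c -> z != r /\ par z = c by rewrite mem_ch => /andP[? /eqP].
have lenE y : y != r -> plen y = plen c by move=> /yc[->//|/cc[]].
split; last by move=> e e'; rewrite -(pvK T e) -(pvK T e') !lenE ?pv_neq.
pose far e := if pv e == c then r else pv e.
exists c, far; split.
- move=> e e'; rewrite /far => E; rewrite -(pvK T e) -(pvK T e'); congr (pe _).
  move: E; have n1 := pv_neq T e; have n2 := pv_neq T e'.
  have [E1|_] := eqVneq (pv e) c; have [E2|_] := eqVneq (pv e') c => // E.
  - by rewrite E1 E2.
  - by rewrite -E eqxx in n2.
  - by rewrite E eqxx in n1.
- move=> e; rewrite /far; have [E|ne] := eqVneq (pv e) c.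
    by split => //; rewrite eq_sym; exact: child_neq.
  split => //; rewrite (leaf_rooted T (pv_neq T e)).
  by case: (yc _ (pv_neq T e)) => [E|/cc[-> _]//]; rewrite E eqxx in ne.
- move=> e; rewrite /far -{1}(pvK T e); have [->|ne] := eqVneq (pv e) c.
    by have := pe_joins T child_neq; rewrite child_par.
  case: (yc _ (pv_neq T e)) => [E|/zr[_ pc]]; first by rewrite E eqxx in ne.
  by apply: joinsC; have := pe_joins T (pv_neq T e); rewrite pc.
- move=> v; have [->|vr] := eqVneq v r.
    by right; exists (pe c); rewrite /far peK ?child_neq // eqxx.
  case: (yc v vr) => [->|vc]; [by left|right]; exists (pe v).
  by rewrite /far peK // (negbTE (ch_neq vc)).
Qed.

Lemma star_like_rooted : suppressed G ->
  star_like <-> interval_graph G \/ equilateral_star_graph G.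
Proof.
move=> sup; split.
  move=> [cc|cc]; first by left; exact: interval_rooted.
  have [E|cn] := eqVneq (ch c) [::]; first by left; exact: interval_rooted.
  by right; exact: star_rooted.
have [E|cn] := eqVneq (ch c) [::]; first by left.
have [z zc] : exists z, z \in ch c.
  by move: cn; case E : (ch c) => [//|z zs] _; exists z; rewrite mem_head.
move=> [[e [u [v [_ _ one _]]]]|[[c' [far [_ fl _ all]]] eq]].
  have zr : z != r by move: zc; rewrite mem_ch => /andP[].
  have E : z = c by apply: (@pe_inj _ _ _ T _ _ zr child_neq); rewrite (one (pe z)) (one (pe c)).
  by have := ch_neq zc; rewrite E eqxx.
have nleaf v : ~~ leaf v -> v = c'.
  by move=> nl; case: (all v) => [//|[e E]]; have [_] := fl e; rewrite -E (negbTE nl).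
have cc' : c = c' by apply: nleaf; rewrite (leaf_rooted T child_neq).
right=> y yin; split; last exact: eq.
have yr : y != r by move: yin; rewrite mem_ch => /andP[].
apply/eqP; rewrite -(leaf_rooted T yr); apply: contraT => /nleaf E.
by have := ch_neq yin; rewrite E cc' eqxx.
Qed.

(** What [second_zero] leaves over is a root edge of length [pi / (2 * k)] with flat branches at
    [c]. Absent vertices of degree two a flat branch is a single edge, and [flat_Edge] gives it the
    same length. *)
Lemma first_zero_star_like k : suppressed G -> 0 < k ->
  bval (subtree c) k = 0 -> (forall s, 0 < s < k -> bval (subtree c) s != 0) ->
  (exists2 s, k < s < 2 * k & bval (subtree c) s = 0) \/ star_like.
Proof.
move=> sup k0 uk nz; have cr := child_neq.
(* The parent edge counts in the degree, so a single child would mean degree two. *)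
have big x : x != r -> ch x <> [::] -> exists B C Bs,
    [seq subtree y | y <- ch x] = [:: B, C & Bs].
  move=> xr; have := sup x; rewrite (degree_rooted T) xr.
  by case: (ch x) => [|y [|z zs]] //= _ _; exists (subtree y), (subtree z), [seq subtree w | w <- zs].
have [E|cn] := eqVneq (ch c) [::]; first by right; left.
have [B [C [Bs E]]] := big c cr (elimN eqP cn).
have wE := wf_subtree T cr; move: wE uk nz; rewrite subtreeE // E => wE uk nz.
have [z|[kl pB fB]] := @second_zero R _ (joinl B (C :: Bs)) k k0 wE isT uk nz; first by left.
right; right => z zc; have zr : z != r by move: zc; rewrite mem_ch => /andP[].
have iz : (index z (ch c) < (size (C :: Bs)).+1)%N.
  by have := congr1 size E; rewrite size_map /= => <-; rewrite index_mem.
have nthz : nth B (B :: C :: Bs) (index z (ch c)) = subtree z.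
  by rewrite -E (nth_map c) ?index_mem // nth_index.
have := flat_joinl fB iz; have := pos_joinl pB iz; rewrite nthz subtreeE // => pz fz.
have [Ez|nz'] := eqVneq (ch z) [::].
  split => //; move: pz fz; rewrite Ez /= => pz fz.
  have /= := @flat_Edge R k (plen z) (len_gt0 _) k0 pz fz; rewrite -kl.
  by move/(mulfI (lt0r_neq0 k0)).
have [B' [C' [Bs' E']]] := big z zr (elimN eqP nz').
by exfalso; move: fz; rewrite E' /= => -[].
Qed.

Lemma star_like_zeros k : star_like -> 0 < k ->
  bval (subtree c) k = 0 -> (forall s, 0 < s < k -> bval (subtree c) s != 0) ->
  bval (subtree c) (2 * k) = 0 /\ forall s, k < s < 2 * k -> bval (subtree c) s != 0.
Proof.
move=> sl k0; rewrite subtreeE ?child_neq //.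
have [E|cn] := eqVneq (ch c) [::]; first by rewrite E; exact: edge_zeros (len_gt0 _) k0.
case: sl => [E|cc]; first by rewrite E in cn.
have -> : [seq subtree y | y <- ch c] = nseq (size (ch c)) (Edge (plen c)).
  apply: (@eq_from_nth _ (Edge 1)); rewrite ?size_nseq size_map // => i ic.
  rewrite (nth_map c) // nth_nseq ic; have zc := mem_nth c ic; have [E L] := cc _ zc.
  rewrite subtreeE; last by move: zc; rewrite mem_ch => /andP[].
  by rewrite E L.
by case: (ch c) cn => [//|z zs] _; exact: star_zeros (len_gt0 _) k0.
Qed.

(** At the inner end of the root edge the value at [k] is still positive, and the edge only rotates
    the state. *)
Lemma first_zero_nondegenerate k : 0 < k ->
  bval (subtree c) k = 0 -> (forall s, 0 < s < k -> bval (subtree c) s != 0) ->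
  bstate (subtree c) k <> (0, 0).
Proof.
move=> k0 uk nz E; have wE := wf_subtree T child_neq.
move: wE uk nz E; rewrite subtreeE ?child_neq //.
case: [seq _ | _ <- _] => [|B Bs] /=.
  move=> l0 _ _ [s0 c0]; have := cos2Dsin2 (k * plen c).
  by rewrite s0 c0 expr0n /= addr0 => /esym/eqP; rewrite oner_eq0.
move=> wE uk nz E; have [l0 wB] := wE.
have D s : 0 < s < k -> 0 < secular (joinl B Bs) (Edge (plen c)) s.
  rewrite secular_Edge; apply: pos_before_zero => //; first exact: bval_continuous.
  exact: bval_near0.
have [_ _ uB _] := @secular_pos2 R (joinl B Bs) (Edge (plen c)) k k0 wB l0 D.
have [h1 h2] : bval (Ext (plen c) (joinl B Bs)) k = 0 /\ bder (Ext (plen c) (joinl B Bs)) k = 0.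
  by case: E => E1 E2; split.
have := norm_Ext (plen c) (joinl B Bs) k; rewrite h1 h2 expr0n /= addr0 => /esym/eqP.
by rewrite gt_eqF // ltr_pwDl ?sqr_ge0 // exprn_gt0.
Qed.

End LeafRooted.

Theorem theorem1p2 (R : realType) (G : metric_graph R)
    (Gtree : is_tree G) (Gsupp : suppressed G) (lam1 lam2 : R)
    (lam1P : is_kth_eigenvalue G 1 lam1) (lam2P : is_kth_eigenvalue G 2 lam2) :
  lam2 / lam1 <= 4 /\
  (lam2 / lam1 = 4 <-> interval_graph G \/ equilateral_star_graph G).
Proof.
have [/eigenvalue_count1_inv [lam [f [/= lam_le Hf nf]]] min1] := lam1P.
have [e0 _] := nf; have [r lr] := tree_leaf e0 Gtree.
have [T] := tree_rooting e0 r Gtree.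
have [c chr] : exists c, ch T r = [:: c].
  by move: lr; rewrite (leaf_root T); case: (ch T r) => [|c []] // _; exists c.
pose u := bval (subtree T c).
have lamE : lam = lam1.
  apply/eqP; rewrite eq_le lam_le leNgt; apply/negP => lt; apply: min1.
  exact: (@eigenvalue_count1 _ _ _ lam f).
subst lam; have [lam0 uk] := eigen_zero lr chr Hf nf.
set k := Num.sqrt lam1 in uk; have k0 : 0 < k by rewrite sqrtr_gt0.
have kk : k ^+ 2 = lam1 by rewrite sqr_sqrtr // ltW.
have nz s : 0 < s < k -> u s != 0.
  move=> /andP[s0 sk]; apply/eqP => us; apply: min1.
  have [g Hg ng] := zero_eigen lr chr s0 us.
  by apply: (eigenvalue_count1 _ Hg ng); rewrite /= -kk ltr_pXn2r // nnegrE ltW.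
(* A later zero gives an eigenvalue different from [lam1], so the upper bound needs no
   multiplicities. *)
have upper s : k < s -> u s = 0 -> lam2 <= s ^+ 2.
  move=> ks us; rewrite leNgt; apply/negP => lt; have [_] := lam2P; apply.
  have s0 := lt_trans k0 ks; have [g Hg ng] := zero_eigen lr chr s0 us.
  have ks2 : lam1 < s ^+ 2 by rewrite -kk ltr_pXn2r // nnegrE ltW.
  apply: (@eigenvalue_count2 _ _ _ lam1 (s ^+ 2) f g) => //=; first by rewrite lt_eqF.
  exact: lt_trans lt.
have four : 4 * lam1 = (2 * k) ^+ 2 by rewrite -kk; ring.
have SL := star_like_rooted lr chr Gsupp.
have [[s /andP[ks s2] us]|sl] := first_zero_star_like chr Gsupp k0 uk nz.
  have lt : lam2 / lam1 < 4.
    rewrite ltr_pdivrMr // four (le_lt_trans (upper s ks us)) //.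
    by rewrite ltr_pXn2r // nnegrE ltW // ?mulr_gt0 // (lt_trans k0).
  split; first exact: ltW.
  split=> [E|/SL sl]; first by rewrite E ltxx in lt.
  have [_ /(_ s)] := star_like_zeros chr sl k0 uk nz.
  by rewrite ks s2 us eqxx => /(_ isT).
have [u2 nz2] := star_like_zeros chr sl k0 uk nz.
have le : lam2 <= 4 * lam1 by rewrite four; apply: upper => //; lra.
(* Here multiplicity matters: two independent eigenfunctions with eigenvalues below [4 * lam1] would
   both belong to [lam1], which is simple. *)
have ge : 4 * lam1 <= lam2.
  rewrite leNgt; apply/negP => lt.
  have [/eigenvalue_count2_inv [mu [nu [g [h [/= mul nul Hg Hh ind]]]]] _] := lam2P.
  have [ng nh] := lin_indep_nonzero ind.
  have only (m : R) (p : edge G -> R -> R) : m <= lam2 -> in_eigenspace m p -> nonzero p -> m = k ^+ 2.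
    move=> ml Hp np; have [m0 um] := eigen_zero lr chr Hp np.
    have sm0 : 0 < Num.sqrt m by rewrite sqrtr_gt0.
    have smm : Num.sqrt m ^+ 2 = m by rewrite sqr_sqrtr // ltW.
    have sm2 : Num.sqrt m < 2 * k.
      rewrite -(@ltr_pXn2r _ 2) // ?nnegrE ?ltW ?mulr_gt0 // smm -four.
      exact: le_lt_trans lt.
    have [lt1|lt1|E] := ltrgtP (Num.sqrt m) k.
    - by have := nz (Num.sqrt m); rewrite sm0 lt1 /u um eqxx => /(_ isT).
    - by have := nz2 (Num.sqrt m); rewrite lt1 sm2 um eqxx => /(_ isT).
    - by rewrite -smm E.
  have mk := only mu g mul Hg ng; have nk := only nu h nul Hh nh.
  rewrite mk in Hg; rewrite nk in Hh.
  exact: (simple_eigen lr chr k0 (first_zero_nondegenerate chr k0 uk nz) Hg Hh ind).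
have E : lam2 = 4 * lam1 by apply/eqP; rewrite eq_le le ge.
rewrite E mulfK ?gt_eqF //; split=> //; split => // _; exact/SL.
Qed.
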